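(* Let $T$ be a tree. Let $(G_{\circ}, l_{\circ})$ be the canonical model for $T$ and $V_1 \subset V(G_{\circ})$ the subset of all leaf ends. Then there exists a generating set of $\operatorname{Rat}(T)$ (as a semifield over $\boldsymbol{T}$) consisting of at most $\frac{[\# V_1 + 1]}{2}$ elements, where $[x] = \max\{n \in \boldsymbol{Z} \mid n \le x\}$.
   Context: Graphs are unweighted, undirected, finite, connected, nonempty multigraphs that may have loops. The valence of a vertex is the number of incident edges, loops counted twice; a leaf end is a vertex of valence one; a leaf edge is an edge incident to a leaf end. An edge-weighted graph $(G,l)$ is a graph $G$ with a function $l : E(G) \to \boldsymbol{R}_{>0} \cup \{\infty\}$ that takes the value $\infty$ only on leaf edges. A tropical curve is the underlying topological space of an edge-weighted graph $(G,l)$ (called a model) together with an identification of each edge $e$ with $[0,l(e)]$, where $[0,\infty]$ is the one-point compactification of $[0,\infty)$; if $l(e)=\infty$, the leaf end of $e$ is identified with $\infty$ (if $E(G)=\{e\}$ and $l(e)=\infty$, either leaf end may be identified with $\infty$). Points identified with $\infty$ are called points at infinity; all other points are finite points. A tree is a tropical curve of genus (first Betti number) zero. The valence $\operatorname{val}(x)$ of a finite point $x$ is the number of connected components of $U\setminus\{x\}$ for any sufficiently small connected neighborhood $U$ of $x$; a point at infinity has valence $1$. The canonical model $(G_{\circ}, l_{\circ})$ of a tropical curve is the model whose vertex set is the set of points of valence $\neq 2$, with two exceptions: if the curve is homeomorphic to a circle, $V(G_{\circ})$ consists of one arbitrary point; if the curve has a model whose graph is a path with three vertices and two edges, both of length $\infty$,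 then $V(G_{\circ})$ consists of the two points at infinity and any one finite point. A rational function on a tropical curve $\varGamma$ is either the constant function $-\infty$, or a continuous map $f : \varGamma \to \boldsymbol{R} \cup \{\pm\infty\}$ that is piecewise affine with integer slopes and finitely many pieces and that takes the values $\pm\infty$ only at points at infinity. $\operatorname{Rat}(\varGamma)$ is the set of all rational functions on $\varGamma$, with $(f \oplus g)(x) = \max\{f(x),g(x)\}$ and $(f \odot g)(x) = f(x)+g(x)$ at finite points $x$, extended continuously to points at infinity (and $f \odot (-\infty) = -\infty$). This is a semifield (a commutative semiring with $0\ne1$ in which every nonzero element is multiplicatively invertible) with zero element $-\infty$ and unit the constant function $0$. The tropical semifield $\boldsymbol{T}=(\boldsymbol{R}\cup\{-\infty\},\max,+)$ is included in it as the constant functions. A generating set of $\operatorname{Rat}(\varGamma)$ as a semifield over $\boldsymbol{T}$ is a subset such that the smallest subsemifield containing $\boldsymbol{T}$ and this subset is $\operatorname{Rat}(\varGamma)$. *)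

(* Defs.v *)
From HB Require Import structures.
From mathcomp Require Import all_boot all_order all_algebra.
From mathcomp Require Import all_classical all_reals all_analysis.
Set Implicit Arguments.
Unset Strict Implicit.
Unset Printing Implicit Defensive.
Import Order.TTheory GRing.Theory Num.Theory.
Import numFieldNormedType.Exports.
Local Open Scope classical_set_scope.
Local Open Scope ring_scope.

(* The orientation src -> tgt of an edge carries no graph-theoretic meaning; it
   only fixes the direction in which the edge is parametrized. *)
Definition adjacent (V E : finType) (src tgt : E -> V) : rel V :=
  fun u v => [exists e, ((src e == u) && (tgt e == v)) ||
                        ((src e == v) && (tgt e == u))].

Structure multigraph := Multigraph {
  vertex : finType;
  edge : finType;
  src : edge -> vertex;
  tgt : edge -> vertex;
  multigraph_nonempty : (0 < #|vertex|)%N;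
  multigraph_connected : forall u v : vertex, connect (adjacent src tgt) u v
}.

Section Multigraph.
Variable G : multigraph.

Definition graph_valence (v : vertex G) : nat :=
  (#|[set e : edge G | src e == v]%SET| + #|[set e : edge G | tgt e == v]%SET|)%N.

Definition leaf_end (v : vertex G) : bool := graph_valence v == 1%N.

Definition leaf_edge (e : edge G) : bool := leaf_end (src e) || leaf_end (tgt e).

Definition leaf_ends : {set vertex G} := [set v | leaf_end v]%SET.

(* Euler's formula, G being connected. *)
Definition genus : int := #|edge G|%:Z - #|vertex G|%:Z + 1.

End Multigraph.

Structure weightedGraph (R : realType) := WeightedGraph {
  wgraph :> multigraph;
  len : edge wgraph -> \bar R;
  len_gt0 : forall e, (0 < len e)%E;
  len_infty : forall e, len e = +oo%E -> leaf_edge e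
}.

(* A model exhibits X as the space obtained by gluing one copy of the extended
   real interval [0, len e] per edge e along the vertices. The values of
   [chart e] outside [0, len e] are irrelevant. An edge of infinite length is
   oriented towards the leaf end that is identified with +oo. *)
Structure model (R : realType) (X : topologicalType) := Model {
  mgraph :> weightedGraph R;
  vpoint : vertex mgraph -> X;
  chart : edge mgraph -> \bar R -> X;
  len_infty_tgt : forall e : edge mgraph, len e = +oo%E -> leaf_end (tgt e);
  chart_src : forall e : edge mgraph, chart e 0%E = vpoint (src e);
  chart_tgt : forall e : edge mgraph, chart e (len e) = vpoint (tgt e);
  vpoint_inj : injective vpoint;
  chart_inj : forall (e e' : edge mgraph) t t', (0 < t < len e)%E -> (0 < t' < len e')%E ->
    chart e t = chart e' t' -> e = e' /\ t = t';
  chart_vpoint : forall (e : edge mgraph) t v, (0 < t < len e)%E -> chart e t <> vpoint v;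
  model_surj : forall x, (exists v, x = vpoint v) \/
    (exists e : edge mgraph, exists2 t, (0 < t < len e)%E & x = chart e t);
  model_open : forall U : set X, open U <->
    forall e : edge mgraph, open (chart e @^-1` U : set (subspace `[0%E, len e]))
}.

(* Two models on the same space define the same tropical curve when the changes
   of charts between open edges are isometries, i.e. of the form t |-> c +- t on
   each interval. *)
Definition same_curve (R : realType) (X : topologicalType) (M N : model R X) :=
  forall (e : edge M) (e' : edge N) (a b : R),
    0 < a -> a <= b -> (b%:E < len e)%E ->
    (forall t : R, a <= t <= b ->
       exists2 u, (0 < u < len e')%E & chart e t%:E = chart e' u) ->
    exists (c : R) (s : bool), forall t : R, a <= t <= b ->
      (0 < (c + (-1) ^+ s * t)%:E < len e')%E /\
      chart e t%:E = chart e' (c + (-1) ^+ s * t)%:E.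

Structure tropicalCurve (R : realType) := TropicalCurve {
  space :> topologicalType;
  curve_model : model R space
}.

Section TropicalCurve.
Variables (R : realType) (T : tropicalCurve R).

Definition is_model (M : model R T) : Prop := same_curve (curve_model T) M.

Definition is_tree : Prop := genus (curve_model T) = 0.

Definition at_infinity : set T :=
  [set x | exists2 e : edge (curve_model T), len e = +oo%E & x = chart e +oo%E].

Definition components (X : topologicalType) (A : set X) : set (set X) :=
  [set connected_component A y | y in A].

(* [get] selects the only element of the set, by local connectedness. *)
Definition valence (x : T) : nat :=
  if `[< at_infinity x >] then 1%N
  else get [set n | exists2 U0 : set T, nbhs x U0 &
         forall U : set T, nbhs x U -> U `<=` U0 -> connected U ->
           (components (U `\ x) #= `I_n)%card].

Definition circle : set (R * R) := [set p | p.1 ^+ 2 + p.2 ^+ 2 = 1].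

Definition homeomorphic_to_circle : Prop :=
  exists2 f : T -> R * R, set_bij setT circle f &
    forall U : set T, open U <-> exists2 W : set (R * R), open W & U = f @^-1` W.

(* A connected graph with three vertices and two edges is a path. *)
Definition is_infinite_line : Prop :=
  exists M : model R T, [/\ is_model M, #|vertex M| = 3%N, #|edge M| = 2%N &
    forall e : edge M, len e = +oo%E].

Definition is_canonical_model (M : model R T) : Prop :=
  [/\ is_model M,
      homeomorphic_to_circle -> #|vertex M| = 1%N,
      is_infinite_line -> exists2 p : T, ~ at_infinity p &
        range (@vpoint R T M) = at_infinity `|` [set p] &
      ~ homeomorphic_to_circle -> ~ is_infinite_line ->
        range (@vpoint R T M) = [set x | valence x <> 2%N]].

(* The breakpoints of f on an edge are 0 and the elements of s. *)
Definition piecewise_affine (f : T -> \bar R) : Prop :=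
  forall e : edge (curve_model T), exists s : seq (\bar R),
    [/\ path <%O 0%E s, last 0%E s = len e &
        forall i, (i < size s)%N -> exists (m : int) (q : R), forall t : R,
          (nth 0%E (0%E :: s) i <= t%:E <= nth 0%E (0%E :: s) i.+1)%E ->
          f (chart e t%:E) = (m%:~R * t + q)%:E].

Definition trop0 : T -> \bar R := cst -oo%E.
Definition trop1 : T -> \bar R := cst 0%E.

Definition rational : set (T -> \bar R) :=
  [set f | f = trop0 \/
    [/\ continuous f, piecewise_affine f &
        forall x, f x = +oo%E \/ f x = -oo%E -> at_infinity x]].

Definition trop_add (f g : T -> \bar R) : T -> \bar R :=
  fun x => Order.max (f x) (g x).

(* The sum is well defined at finite points, and in particular on a punctured
   neighbourhood of any point at infinity. *)
Definition trop_mul (f g : T -> \bar R) : T -> \bar R :=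
  fun x => if `[< at_infinity x >] then lim ((fun y => f y + g y)%E @ x^')
           else (f x + g x)%E.

Definition trop_const : set (T -> \bar R) :=
  [set cst c | c in [set c : \bar R | c <> +oo%E]].

Definition subsemifield (A : set (T -> \bar R)) : Prop :=
  [/\ A `<=` rational, A trop0 /\ A trop1,
      forall f g, A f -> A g -> A (trop_add f g),
      forall f g, A f -> A g -> A (trop_mul f g) &
      forall f g, A f -> rational g -> trop_mul f g = trop1 -> A g].

Definition generating_set (S : set (T -> \bar R)) : Prop :=
  S `<=` rational /\ smallest subsemifield (trop_const `|` S) = rational.

End TropicalCurve.
Arguments is_tree {R} T.

(* Main.v *)
Require Import Defs.
From mathcomp Require Import all_boot all_order all_algebra.
From mathcomp Require Import fingroup perm.
From mathcomp Require Import zify ring lra.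
From mathcomp Require Import all_classical all_reals all_analysis.
Set Implicit Arguments.
Unset Strict Implicit.
Unset Printing Implicit Defensive.
Import Order.TTheory GRing.Theory Num.Theory.
Import numFieldNormedType.Exports.
Local Open Scope classical_set_scope.
Local Open Scope ring_scope.

(** For an edge e of the tree let h_e be the coordinate of the retraction of the
    tree onto e: it is 0 on one side of e, the length of e on the other side,
    and the identity on e. The coordinates h_e generate all rational functions.
    Indeed, if phi_e is the restriction of a rational function g to e, then g
    minus the sum of the functions phi_e(h_e) does not vary along any edge, so
    it is constant; and phi_e(h_e), a piecewise affine function of one variable
    with integer slopes, is a telescoping sum of integer multiples of
    truncations of h_e (lemma rational_generated).

    Few functions suffice to produce all h_e. For two vertices a and b, let f_ab
    be, up to a constant, the coordinate along the path from a to b of the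
    projection to this path. If the path runs through e, then h_e is obtained
    from f_ab by a change of sign, a translation and a truncation
    (truncate_path_coordinate). It is therefore enough to cover the tree by at
    most (L + 1)/2 paths, where L is the number of leaf ends. List the leaf
    ends, add one vertex if L is odd, and among all ways of pairing the members
    of this list take one that maximises the total length of the paths. If an
    edge were on no path, there would be a pair on either side of it, since both
    sides contain leaf ends, and exchanging partners between these two pairs
    would make the paths longer (dist_swap, pairing_covers).

    In a graph of genus 0 every edge is a bridge, by a rank computation for the
    incidence matrix (edge_potential); the combinatorics then rests on the fact
    that two bridges cut the graph into three parts only (side_laminar).

    The number of leaf ends may be counted in any model, because leaf ends are
    determined by the topology: a point that is not a leaf end is isolated or
    cuts small neighbourhoods of itself, whereas a leaf end has arbitrarily small
    neighbourhoods that stay connected without it (leaf_ends_le).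

    Rational functions are handled through their one-sided affine germs, which
    can be added and compared without subdividing edges; compactness of the
    edges leads back to finitely many pieces (locally_affine_pieces). A nonzero
    rational function is determined by its finite values at finite points
    (PL_ext), so inside a subsemifield the computations above take place among
    real-valued functions (represents). *)

(** * Trees: sides of edges and pairings of leaf ends *)

Section Graph.
Variable G : multigraph.
Implicit Types (u v : vertex G) (e : edge G).

(** A pair of an edge and a boolean stands for an end of the edge, the boolean
    telling whether it is the target; the two ends of a loop are distinct. *)
Definition endpoint (p : edge G * bool) : vertex G :=
  if p.2 then tgt p.1 else src p.1.

Definition ends v : {set edge G * bool} := [set p | endpoint p == v]%SET.

Lemma card_ends v : #|ends v| = graph_valence v.
Proof.
rewrite /graph_valence -!sum1_card.
rewrite (eq_bigl (fun p => endpoint p == v)); last by move=> p; rewrite inE.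
rewrite (eq_bigr (fun p : edge G * bool => (fun=> fun=> 1%N) p.1 p.2)) //.
rewrite -(pair_big_dep xpredT (fun e b => endpoint (e, b) == v) (fun=> fun=> 1%N)) /=.
under eq_bigr => e _ do rewrite big_mkcond big_bool /= /endpoint /=.
rewrite big_split /= addnC -!big_mkcond /=.
by congr addn; apply: eq_bigl => e; rewrite inE.
Qed.

Lemma leaf_end_unique p q : leaf_end (endpoint p) -> endpoint p = endpoint q -> p = q.
Proof.
rewrite /leaf_end -card_ends => /cards1P[r Er] Epq.
have: p \in ends (endpoint p) by rewrite inE.
have: q \in ends (endpoint p) by rewrite inE Epq.
by rewrite !Er !inE => /eqP-> /eqP->.
Qed.

Lemma connected_const (C : Type) (c : vertex G -> C) :
  (forall e, c (src e) = c (tgt e)) -> forall u v, c u = c v.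
Proof.
move=> ce u v; have /connectP[s us ->] := multigraph_connected u v.
elim: s u us => //= w s IHs u /andP[/existsP[e uw] /IHs <-].
by case/orP: uw => /andP[/eqP<- /eqP<-]; rewrite ce.
Qed.

Lemma ends_neq0 e v : exists p, endpoint p = v.
Proof.
apply: contrapT => /forallNP Nv.
have: (v == v) = (src e == v).
  apply: (connected_const (c := fun x => x == v)) => e'.
  have /eqP/negPf-> := Nv (e', false).
  by have /eqP/negPf-> := Nv (e', true).
by rewrite eqxx => /esym/eqP; apply: (Nv (e, false)).
Qed.

(** The coboundary map from vertex functions to edge functions has only the
    constants in its kernel, so by Euler's formula it is onto when the genus is
    zero. A preimage of the indicator of [e] cannot change along a path that
    avoids [e], hence [e] is a bridge. *)
Lemma edge_potential e : genus G = 0 ->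
  exists f : vertex G -> rat, forall e', f (tgt e') - f (src e') = (e' == e)%:R.
Proof.
move=> G0.
pose D : 'M[rat]_(#|vertex G|, #|edge G|) := \matrix_(i, j)
  ((enum_val i == tgt (enum_val j))%:R - (enum_val i == src (enum_val j))%:R).
have DE (u : 'rV_#|vertex G|) j : (u *m D) 0 j =
    u 0 (enum_rank (tgt (enum_val j))) - u 0 (enum_rank (src (enum_val j))).
  rewrite !mxE; under eq_bigr => i _ do rewrite mxE mulrBr.
  rewrite sumrB; congr (_ - _).
    rewrite (bigD1 (enum_rank (tgt (enum_val j)))) //= enum_rankK eqxx mulr1.
    rewrite big1 ?addr0 // => i /negPf Ni.
    by rewrite -(inj_eq enum_rank_inj) enum_valK Ni mulr0.
  rewrite (bigD1 (enum_rank (src (enum_val j)))) //= enum_rankK eqxx mulr1.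
  rewrite big1 ?addr0 // => i /negPf Ni.
  by rewrite -(inj_eq enum_rank_inj) enum_valK Ni mulr0.
have kerD : (kermx D <= (const_mx 1 : 'rV_#|vertex G|))%MS.
  apply/row_subP => i; set u := row i _.
  have uD : u *m D = 0 by apply/sub_kermxP/row_sub.
  have uc := connected_const (c := fun v => u 0 (enum_rank v)).
  have [v0 _] : exists v0 : vertex G, true.
    by have /card_gt0P[v0 _] := multigraph_nonempty G; exists v0.
  suff -> : u = (u 0 (enum_rank v0)) *: const_mx 1 by apply: scalemx_sub.
  apply/rowP => k; rewrite [RHS]mxE [X in _ * X]mxE mulr1 -[k in LHS]enum_valK.
  apply: uc.
  move=> e'; have := DE u (enum_rank e'); rewrite uD mxE enum_rankK => /esym.
  by move/eqP; rewrite subr_eq0 => /eqP.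
have full : row_full D.
  have rk : (\rank (kermx D) <= 1)%N.
    exact: leq_trans (mxrankS kerD) (rank_leq_row _).
  rewrite mxrank_ker in rk; rewrite /row_full eqn_leq rank_leq_col /=.
  move: G0 rk; rewrite /genus; have := multigraph_nonempty G.
  have arith (r v c : nat) : (r <= v)%N -> (0 < v)%N ->
      c%:Z - v%:Z + 1 = 0 -> (v - r <= 1)%N -> (c <= r)%N by lia.
  exact/arith/rank_leq_row.
have /row_fullP[B DB] := full.
pose u := row (enum_rank e) B.
exists (fun v => u 0 (enum_rank v)) => e'.
rewrite -{1 2}[e']enum_rankK -DE -row_mul DB !mxE.
by rewrite (inj_eq enum_rank_inj) eq_sym.
Qed.

(** The component of the target of [e] once [e] is deleted. *)
Definition side e v : bool :=
  connect (fun x y => [exists e', (e' != e) &&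
    (((src e' == x) && (tgt e' == y)) || ((src e' == y) && (tgt e' == x)))])
    (tgt e) v.

Lemma side_tgt e : side e (tgt e).
Proof. exact: connect0. Qed.

Lemma side_edge e e' : e != e' -> side e (tgt e') = side e (src e').
Proof.
move=> Ne; rewrite /side; apply/idP/idP => /connect_trans; apply;
  apply/connect1/existsP; exists e'; rewrite eq_sym Ne !eqxx ?orbT //.
Qed.

Definition separates e u v : bool := side e u != side e v.

Definition dist u v : nat := (\sum_e separates e u v)%N.

Hypothesis treeG : genus G = 0.

Lemma side_src e : side e (src e) = false.
Proof.
have [f fE] := edge_potential e treeG; apply/negP => /connectP[s sP sE].
suff /eqP : f (tgt e) = f (src e) by rewrite -subr_eq0 fE eqxx oner_eq0.
move: (tgt e) (src e) sP sE => x y.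
elim: s x => [|z s IHs] x /=; first by move=> _ ->.
move=> /andP[/existsP[e' /andP[/negPf Ne xz]]] /IHs{IHs} /[apply] <-.
have := fE e'; rewrite Ne => /eqP; rewrite subr_eq0 => /eqP.
by case/orP: xz => /andP[/eqP-> /eqP->].
Qed.

Lemma no_loop e : src e <> tgt e.
Proof. by move=> E; have := side_tgt e; rewrite -E side_src. Qed.

(** Two bridges cut the graph into three parts, so among the four combinations
    of their sides the one facing away from both edges does not occur. *)
Lemma side_laminar e e' : e != e' ->
  forall x, (side e x == side e (src e')) || (side e' x == side e' (src e)).
Proof.
move=> Ne x; apply: contraT; rewrite negb_or => /andP[N1 N2].
pose c x := (side e x != side e (src e')) && (side e' x != side e' (src e)).
suff /connected_const/(_ x (src e)) : forall e2, c (src e2) = c (tgt e2).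
  by rewrite /c N1 N2 eqxx andbF.
move=> e2; rewrite /c; have Ne' : e' != e by rewrite eq_sym.
have [<-|N] := eqVneq e e2; first by rewrite (side_edge Ne') eqxx !andbF.
have [<-|N'] := eqVneq e' e2; first by rewrite (side_edge Ne) eqxx.
by rewrite !side_edge.
Qed.

(** A vertex at maximal distance on a given side of an edge is a leaf end: of
    two edges at it, one would lead further away. *)
Lemma leaf_on_side e b : exists2 v, leaf_end v & side e v = b.
Proof.
pose u := endpoint (e, ~~ b).
have su : side e u = ~~ b by rewrite /u /endpoint; case: (b); rewrite /= ?side_src ?side_tgt.
pose a0 := endpoint (e, b).
have sa0 : side e a0 == b by rewrite /a0 /endpoint; case: (b); rewrite /= ?side_src ?side_tgt.
have [a /eqP sa amax] := @arg_maxnP _ a0 (fun v => side e v == b) (dist ^~ u) sa0.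
exists a => //; rewrite /leaf_end -card_ends eqn_leq.
apply/andP; split; last first.
  by apply/card_gt0P; have [p pa] := ends_neq0 e a; exists p; rewrite inE; apply/eqP.
rewrite leqNgt; apply/negP => /card_gt1P[p [q [pa qa Npq]]].
rewrite !inE in pa qa.
(* two edges at [a] cannot both separate it from [u], by [side_laminar] *)
suff [r ra su_r] : exists2 r, endpoint r = a & side r.1 u = side r.1 a.
  have Ner : e != r.1.
    by apply/eqP => E; move: su_r; rewrite -E su sa; case: (b).
  pose a' := endpoint (r.1, ~~ r.2).
  have sa' e' : e' != r.1 -> side e' a' = side e' a.
    by move=> N; rewrite -ra /a' /endpoint /=; case: (r.2); rewrite /= side_edge.
  have sr : side r.1 a' = ~~ side r.1 a.
    by rewrite -ra /a' /endpoint; case: (r.2); rewrite /= side_src side_tgt.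
  have := amax a'; rewrite sa' // sa eqxx => /(_ isT).
  have distE v : dist v u =
      (separates r.1 v u + \sum_(e' | e' != r.1) separates e' v u)%N.
    by rewrite /dist (bigD1 r.1).
  rewrite !distE /separates su_r sr eqxx; case: (side _ a); rewrite /= add0n;
   (under eq_bigr => e' N do rewrite sa' //); by rewrite add1n ltnn.
have Ee : p.1 != q.1.
  apply/eqP => E; case: p q E pa qa Npq => [e1 b1] [e2 b2] /= -> /eqP <-.
  by case: b1 b2 => [] [] //=; rewrite ?eqxx // => /eqP; rewrite /endpoint /=;
    [|move/esym]; move=> /no_loop.
have sx r r' : r.1 != r'.1 -> endpoint r' == a -> side r.1 (src r'.1) = side r.1 a.
  by move=> N /eqP <-; rewrite /endpoint; case: ifP; rewrite ?side_edge.
have := side_laminar Ee u; rewrite !sx // 1?eq_sym //.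
by case/orP => /eqP E; [exists p | exists q] => //; apply/eqP.
Qed.

(** If two pairs lie on different sides of an edge, exchanging partners across
    the edge makes both paths run through it and increases the total length. *)
Lemma dist_swap e a b c d : side e a = side e b -> side e c = side e d ->
  side e a != side e c -> (dist a b + dist c d < dist a c + dist b d)%N.
Proof.
move=> ab cd ac; rewrite /dist -!big_split /= (bigD1 e) //= [ltnRHS](bigD1 e) //=.
rewrite /separates -ab -cd ac !eqxx /= -addSn; apply: leq_add => //.
apply: leq_sum => e' Ne.
rewrite eq_sym in Ne.
have La := side_laminar Ne a; have Lc := side_laminar Ne c.
have Lb := side_laminar Ne b; have Ld := side_laminar Ne d.
rewrite -ab in Lb; rewrite -cd in Ld.
move: La Lb Lc Ld ac.
by case: (side e' a); case: (side e' b); case: (side e' c); case: (side e' d);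
 case: (side e' (src e)); case: (side e a); case: (side e c);
 case: (side e (src e')).
Qed.

(** Among all ways of pairing up the points, one of maximal total length has a
    path through every edge, by the exchange above. *)
Lemma pairing_covers k (x : 'I_k * bool -> vertex G) :
  exists y : 'I_k * bool -> vertex G, forall e p q, side e (x p) != side e (x q) ->
    exists i, separates e (y (i, false)) (y (i, true)).
Proof.
pose weight (s : {perm 'I_k * bool}) :=
  (\sum_i dist (x (s (i, false))) (x (s (i, true))))%N.
have [s _ smax] := @arg_maxnP _ 1%g predT weight isT.
exists (x \o s) => e p q xpq; apply: contrapT => /forallNP Ncov.
have {}Ncov i : side e (x (s (i, false))) = side e (x (s (i, true))).
  by have := Ncov i; rewrite /separates => /negP/negPn/eqP.
pose i := ((s^-1)%g p).1; pose j := ((s^-1)%g q).1.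
have xi : side e (x p) = side e (x (s (i, false))).
  rewrite -{1}(permKV s p) /i; case: ((s^-1)%g p) => l [] //=.
have xj : side e (x q) = side e (x (s (j, false))).
  rewrite -{1}(permKV s q) /j; case: ((s^-1)%g q) => l [] //=.
have Nij : j != i by apply: contraNneq xpq => E; rewrite xi xj E.
have : (weight (tperm (i, true) (j, false) * s)%g <= weight s)%N by apply: smax.
rewrite leqNgt => /negP; apply.
rewrite /weight (bigD1 i) //= [ltnRHS](bigD1 i) //=.
rewrite (bigD1 j) //= [X in (_ < _ + X)%N](bigD1 j) //=.
rewrite !addnA !permM tpermL tpermR !tpermD ?xpair_eqE ?eqxx ?andbF //=;
  rewrite ?andbT 1?(negPf Nij) 1?eq_sym ?(negPf Nij) //.
rewrite -addSn; apply: leq_add.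
  by apply: (dist_swap (e := e)); rewrite -?Ncov // -xi -xj.
rewrite leq_sum // => l /andP[Ni Nj].
by rewrite !permM !tpermD //; apply/eqP => -[E]; rewrite ?E ?eqxx in Ni Nj.
Qed.

(** The list of all leaf ends is padded with an arbitrary vertex when their
    number is odd; covering every edge only needs leaf ends on both sides. *)
Lemma leaf_pairs_cover :
  exists y : 'I_(uphalf #|leaf_ends G|) * bool -> vertex G,
    forall e, exists i, separates e (y (i, false)) (y (i, true)).
Proof.
have [v0 _] : exists v0 : vertex G, true.
  by have /card_gt0P[v0 _] := multigraph_nonempty G; exists v0.
set k := uphalf _.
have [y yP] := pairing_covers (fun p : 'I_k * bool =>
  nth v0 (enum (leaf_ends G)) (p.2 * k + p.1)).
have leafE v : leaf_end v -> exists p : 'I_k * bool,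
    v = nth v0 (enum (leaf_ends G)) (p.2 * k + p.1).
  move=> vl; have vL : v \in enum (leaf_ends G) by rewrite mem_enum inE.
  have := index_mem v (enum (leaf_ends G)); rewrite vL -cardE => ltv.
  set n := index _ _ in ltv.
  have nk : (n < k + k)%N.
    by rewrite addnn /k; move: ltv; have := odd_double_half #|leaf_ends G|; lia.
  have [ltn|gen] := ltnP n k.
    by exists (Ordinal ltn, false); rewrite /= mul0n add0n nth_index.
  have ltn' : (n - k < k)%N by lia.
  by exists (Ordinal ltn', true); rewrite /= mul1n subnKC // nth_index.
exists y => e.
have [u /leafE[p ->] sp] := leaf_on_side e false.
have [v /leafE[q ->] sq] := leaf_on_side e true.
by apply: (yP e p q); rewrite sp sq.
Qed.

End Graph.

(** * Leaf ends are determined by the topology *)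

Section ExtendedReals.
Variable R : realType.
Implicit Types (l : \bar R) (t m s : R) (P : set (\bar R)).

Lemma real_between t l : (t%:E < l)%E -> exists2 m, t < m & (m%:E < l)%E.
Proof.
case: l => [r| |] //; last by exists (t + 1); [rewrite ltrDl|rewrite ltry].
by rewrite lte_fin => tr; exists ((t + r) / 2); rewrite ?lte_fin; lra.
Qed.

Lemma near_right t l P : (\forall s \near t%:E, P s) -> (t%:E < l)%E ->
  exists m, [/\ t < m, (m%:E < l)%E & forall s, t <= s -> s < m -> P s%:E].
Proof.
move=> /(@nbhs_ballP _ R)[e /= e0 eP] tl.
have [m tm ml] := real_between tl.
exists (Num.min m (t + e)); split.
- by rewrite lt_min tm ltrDl.
- by apply: le_lt_trans ml; rewrite lee_fin ge_min lexx.
- move=> s ts; rewrite lt_min => /andP[_ se]; apply: eP => /=.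
  by rewrite /ball /= ler0_norm; lra.
Qed.

Lemma near_left l P : (\forall s \near l, P s) -> (0 < l)%E ->
  exists m, [/\ 0 < m, (m%:E < l)%E & forall s, m < s -> (s%:E <= l)%E -> P s%:E].
Proof.
case: l => [r| |] //=.
  move=> /(@nbhs_ballP _ R)[e /= e0 eP]; rewrite lte_fin => r0.
  exists (Num.max (r / 2) (r - e)); split.
  - by rewrite lt_max divr_gt0.
  - by rewrite lte_fin gt_max; apply/andP; lra.
  - move=> s; rewrite gt_max lee_fin => /andP[_ se] sr; apply: eP => /=.
    by rewrite /ball /= ger0_norm; lra.
move=> [M [_ MP]] _; exists (Num.max M 1); split.
- by rewrite lt_max ltr01 orbT.
- by rewrite ltry.
- by move=> s; rewrite gt_max => /andP[Ms _] _; apply: MP; rewrite lte_fin.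
Qed.

Lemma near_neq (a l : \bar R) : l <> a -> \forall s \near l, s <> a.
Proof.
move=> la; have oa : open (~` [set a]).
  by apply/closed_openC/accessible_closed_set1/hausdorff_accessible/ereal_hausdorff.
exact: open_nbhs_nbhs.
Qed.

Lemma near_gt (a l : \bar R) : (a < l)%E -> \forall s \near l, (a < s)%E.
Proof. by move=> al; apply: open_nbhs_nbhs; split => //; apply: open_ereal_gt_ereal. Qed.

Lemma near_lt (a l : \bar R) : (l < a)%E -> \forall s \near l, (s < a)%E.
Proof. by move=> al; apply: open_nbhs_nbhs; split => //; apply: open_ereal_lt_ereal. Qed.

End ExtendedReals.

Section Model.
Variables (R : realType) (X : topologicalType) (M : model R X).
Implicit Types (e : edge M) (p : edge M * bool) (U W : set X) (t : \bar R) (s m : R).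

(** The topology of a model in terms of filters of extended reals instead of
    subspace topologies. *)
Lemma open_chart U : open U <-> forall e t, (0 <= t <= len e)%E -> U (chart e t) ->
  \forall s \near t, (0 <= s <= len e)%E -> U (chart e s).
Proof.
have tI e t : (0 <= t <= len e)%E -> `[0%E, len e]%classic t by rewrite /= in_itv.
split=> [/(model_open M) oU e t te Ut|H].
  have : nbhs (t : subspace `[0%E, len e]) (chart e @^-1` U).
    by apply: open_nbhs_nbhs; split; [exact: oU|].
  move=> /(nbhs_subspace_ex _ (tI e t te))[V tV VU].
  apply: filterS tV => s Vs /tI se.
  by have [] : ((chart e @^-1` U) `&` `[0%E, len e]) s by rewrite VU.
apply/(model_open M) => e; rewrite -open_subspaceIT openE => t [Ut te].
suff : nbhs (t : subspace `[0%E, len e]) ((chart e @^-1` U) `&` `[0%E, len e]) by [].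
apply (nbhs_subspace_ex ((chart e @^-1` U) `&` `[0%E, len e]) te).
exists [set s | (0 <= s <= len e)%E -> U (chart e s)].
  by apply: H => //; move: te; rewrite /= in_itv.
rewrite -setIA setIid; apply/seteqP; split=> s /= [Us se]; split=> //.
by apply: Us; move: se; rewrite in_itv.
Qed.

Lemma chart_near U e t : open U -> (0 <= t <= len e)%E -> U (chart e t) ->
  \forall s \near t, (0 <= s <= len e)%E -> U (chart e s).
Proof. by move=> /open_chart; apply. Qed.

Definition end_param p : \bar R := if p.2 then len p.1 else 0%E.

Lemma chart_end p : chart p.1 (end_param p) = vpoint (endpoint p).
Proof.
by rewrite /end_param /endpoint; case: p => e [] /=; rewrite ?chart_src ?chart_tgt.
Qed.

Lemma chart_eq e e' t t' : (0 < t < len e)%E -> (0 <= t' <= len e')%E ->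
  chart e t = chart e' t' -> e = e' /\ t = t'.
Proof.
move=> te /andP[]; rewrite !le_eqVlt => /orP[/eqP<- _|t'0 /orP[/eqP->|t'l]].
- by rewrite chart_src => /chart_vpoint; case.
- by rewrite chart_tgt => /chart_vpoint; case.
- by apply: chart_inj; rewrite ?t'0.
Qed.

Lemma open_interval e (a b : \bar R) : (0 <= a)%E -> (b <= len e)%E ->
  open (chart e @` [set t | (a < t < b)%E]).
Proof.
move=> a0 bl; apply/open_chart => e' t te' [s /andP[as_ sb] /chart_eq].
have s0 : (0 < s < len e)%E by rewrite (le_lt_trans a0) // (lt_le_trans sb).
move=> /(_ s0 te')[? ?]; subst e' t.
have A := near_gt as_; have B := near_lt sb.
by near=> z => _; exists z => //; apply/andP; split; near: z.
Unshelve. all: by end_near. Qed.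

(** Parameters of a small piece of an edge at its end [p]. *)
Definition germ p m : set R :=
  if p.2 then [set s | m < s /\ (s%:E < len p.1)%E] else [set s | 0 < s /\ s < m].

Lemma germ_range p m s : 0 < m -> (m%:E < len p.1)%E -> germ p m s ->
  (0 < s%:E < len p.1)%E.
Proof.
rewrite /germ => m0 ml; case: ifP => _ [] ms sl; rewrite lte_fin.
  by rewrite sl (lt_trans m0).
by rewrite ms /= (lt_trans _ ml).
Qed.

Lemma germ_in p W : open W -> W (vpoint (endpoint p)) ->
  exists m, [/\ 0 < m, (m%:E < len p.1)%E & forall s, germ p m s -> W (chart p.1 s%:E)].
Proof.
move=> oW; rewrite -chart_end; have l0 := len_gt0 p.1.
move=> /(chart_near oW); rewrite /end_param /germ; case: ifP => _.
  rewrite lexx ltW // => /(_ isT) /near_left/(_ l0)[m [m0 ml mW]].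
  exists m; split=> // s [ms sl]; apply: mW => //; first exact: ltW.
  by rewrite (ltW sl) lee_fin ltW // (lt_trans m0).
rewrite lexx ltW // => /(_ isT) /near_right/(_ l0)[m [m0 ml mW]].
exists m; split=> // s [s0 sm]; apply: mW => //; first exact: ltW.
by rewrite lee_fin (ltW s0) ltW // (lt_trans _ ml).
Qed.

Lemma germ_meet p m m' : 0 < m -> (m%:E < len p.1)%E -> 0 < m' -> (m'%:E < len p.1)%E ->
  exists2 s, germ p m s & germ p m' s.
Proof.
move=> m0 ml m'0 m'l; rewrite /germ; case: ifP => _.
  have [|s ms sl] := @real_between _ (Num.max m m') (len p.1).
    by rewrite EFin_max gt_max ml.
  by exists s; split=> //; apply: le_lt_trans ms; rewrite le_max lexx ?orbT.
exists (Num.min m m' / 2); split; rewrite ?divr_gt0 // ?lt_min ?m0 //.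
  by rewrite ltr_pdivrMr // gt_min; apply/orP; left; lra.
by rewrite ltr_pdivrMr // gt_min; apply/orP; right; lra.
Qed.

(** A leaf end belongs to no other edge end, so the half-open piece of its edge
    is a neighbourhood. *)
Lemma star_open p m : leaf_end (endpoint p) -> 0 < m -> (m%:E < len p.1)%E ->
  open ([set vpoint (endpoint p)] `|` chart p.1 @` (EFin @` germ p m)).
Proof.
move=> leafp m0 ml; apply/open_chart => e t te [/= E|[_ [s sg <-]]]; last first.
  have s0 := germ_range m0 ml sg.
  move=> /(chart_eq s0 te)[? ?]; subst e t.
  have [sp sl] := andP s0; have zlt := near_lt sl.
  have zgerm : \forall z \near s%:E, z \is a fin_num -> germ p m (fine z).
    move: sg; rewrite /germ; case: ifP => _ /= [sm sm'].
      have zgt : \forall z \near s%:E, (m%:E < z)%E by exact: near_gt.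
      by near=> z => zf; split; rewrite -?lte_fin fineK //; near: z.
    have zgt : \forall z \near s%:E, (z < m%:E)%E by exact: near_lt.
    have z0 := near_gt sp.
    by near=> z => zf; split; rewrite -?lte_fin fineK //; near: z.
  near=> z => /andP[z0 _]; right; exists z => //.
  have zr : z \is a fin_num.
    by rewrite ge0_fin_numE // (lt_le_trans (y := len p.1)) ?leey //; near: z.
  by exists (fine z); rewrite ?fineK //; move: zr; near: z.
have [q pE] : exists q : edge M * bool, q.1 = e /\ t = end_param q.
  have [t0|t0] := eqVneq t 0%E; first by exists (e, false).
  have [tl|tl] := eqVneq t (len e); first by exists (e, true).
  have : (0 < t < len e)%E by rewrite !lt_neqAle eq_sym t0 tl.
  by move=> /chart_vpoint; rewrite E => /(_ (endpoint p)).
case: pE => ? ?; subst e t.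
have {E} pq : p = q.
  by apply: leaf_end_unique => //; apply: (@vpoint_inj _ _ M); rewrite -E chart_end.
subst q; rewrite /end_param /germ in te *; case: ifP => b.
  have A := near_gt ml.
  near=> z => ze; have [zl|zl] := eqVneq z (len p.1).
    by left; rewrite zl /= -chart_end /end_param b.
  have zl' : (z < len p.1)%E by rewrite lt_neqAle zl; case/andP: ze.
  have zr : z \is a fin_num.
    by rewrite ge0_fin_numE; [exact: (lt_le_trans zl' (leey _))|case/andP: ze].
  right; exists z => //; exists (fine z); rewrite ?fineK //; split; rewrite ?fineK //.
  by rewrite -lte_fin fineK //; near: z.
have A : (\forall z \near 0%E, z < m%:E)%E by apply: near_lt; rewrite lte_fin.
near=> z => ze; have zm : (z < m%:E)%E by near: z.
have [z0|z0] := eqVneq z 0%E.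
  by left; rewrite z0 /= -chart_end /end_param b.
have zr : z \is a fin_num.
  by rewrite ge0_fin_numE; [exact: (lt_le_trans zm (leey _))|case/andP: ze].
right; exists z => //; exists (fine z); rewrite ?fineK //; split.
  by rewrite -lte_fin fineK // lt_neqAle eq_sym z0; case/andP: ze.
by rewrite -lte_fin fineK.
Unshelve. all: by end_near. Qed.

(** Connectedness of real intervals, transported by the chart. *)
Lemma germ_connected p m (A B : set X) : open A -> open B -> A `&` B `<=` set0 ->
  0 < m -> (m%:E < len p.1)%E ->
  (forall s, germ p m s -> A (chart p.1 s%:E) \/ B (chart p.1 s%:E)) ->
  (exists2 s, germ p m s & A (chart p.1 s%:E)) ->
  forall s, germ p m s -> A (chart p.1 s%:E).
Proof.
move=> oA oB AB m0 ml cov [s0 s0g As0].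
have ogerm C : open C -> open [set s | germ p m s /\ C (chart p.1 s%:E)].
  move=> oC; rewrite openE => s [sg Cs]; rewrite /interior /=.
  have /andP[sp sl] := germ_range m0 ml sg.
  have := chart_near oC _ Cs; rewrite !ltW // => /(_ isT) H.
  have zgerm : \forall z \near s, germ p m z.
    move: sg; rewrite /germ; case: ifP => _ /= [sm sm'].
      have zgt : \forall z \near s, m < z by exact: lt_nbhsr.
      have zlt : \forall z \near s, (z%:E < len p.1)%E by exact: (near_lt sm').
      by near=> z; split; near: z.
    have zgt : \forall z \near s, 0 < z by exact: lt_nbhsr.
    have zlt : \forall z \near s, z < m by exact: lt_nbhsl.
    by near=> z; split; near: z.
  have {}H : \forall z \near s, (0 <= z%:E <= len p.1)%E -> C (chart p.1 z%:E) by [].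
  near=> z; have zg : germ p m z by near: z.
  split=> //; have /andP[z0 zl] := germ_range m0 ml zg.
  have ze : (0 <= z%:E <= len p.1)%E by rewrite !ltW.
  by move: ze; near: z.
have : connected (germ p m).
  apply/connected_intervalP => x y; rewrite /germ; case: ifP => _ /= [a1 a2] [b1 b2] z /andP[xz zy].
    by split; [exact: lt_le_trans xz|apply: le_lt_trans b2; rewrite lee_fin].
  by split; [exact: lt_le_trans xz|exact: le_lt_trans b2].
move=> /(_ [set s | germ p m s /\ A (chart p.1 s%:E)]) H s sg.
suff : [set s | germ p m s /\ A (chart p.1 s%:E)] s by case.
rewrite H //; first by exists s0.
- exists [set s | germ p m s /\ A (chart p.1 s%:E)]; first exact: ogerm.
  by apply/seteqP; split=> z /= [] // ? [].
- exists (~` [set s | germ p m s /\ B (chart p.1 s%:E)]).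
    exact/open_closedC/ogerm.
  apply/seteqP; split=> z /= [zg zA].
    by split=> // -[_ zB]; apply: (AB (chart p.1 z%:E)).
  by split=> //; case: (cov z zg) => // zB; case: zA.
Unshelve. all: by end_near. Qed.

End Model.

Section LocalCut.
Variables (R : realType) (X : topologicalType).

(** A substitute for having valence at least two that does not refer to any
    model. *)
Definition locally_cut (x : X) : Prop := exists A B : set X,
  [/\ open A, open B, A `&` B `<=` set0, open ([set x] `|` A `|` B) &
      ~ A x /\ ~ B x /\
      forall U : set X, open U -> U x -> (U `&` A !=set0) /\ (U `&` B !=set0)].

(** Removing a leaf end from its half-open neighbourhood leaves an interval,
    which cannot meet both parts of a cut. *)
Lemma leaf_not_cut (M : model R X) p : leaf_end (endpoint p) ->
  ~ locally_cut (vpoint (m := M) (endpoint p)).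
Proof.
move=> leafp [A [B [oA oB AB oW [NAx [NBx acc]]]]]; set x := vpoint _ in NAx NBx acc oW.
have Wx : ([set x] `|` A `|` B) x by left; left.
have [m [m0 ml mW]] := germ_in oW Wx.
have [[y [Uy Ay]] [z [Uz Bz]]] := acc _ (star_open leafp m0 ml) (or_introl erefl).
have cov s : germ p m s -> A (chart p.1 s%:E) \/ B (chart p.1 s%:E).
  move=> sg; have [[/= E|]|] := mW s sg; [|by left|by right].
  by have /chart_vpoint := germ_range m0 ml sg; move/(_ _ E).
case: Uy => [/= Ey|[_ [s sg <-] Es]]; first by case: NAx; rewrite /x -Ey.
have gA : forall s, germ p m s -> A (chart p.1 s%:E).
  by apply: (germ_connected oA oB) => //; exists s => //; rewrite Es.
case: Uz => [/= Ez|[_ [s' s'g <-] Es']]; first by case: NBx; rewrite /x -Ez.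
by apply: (AB z); split=> //; rewrite -Es'; apply: gA.
Qed.

Lemma leaf_not_isolated (M : model R X) p : ~ open [set vpoint (m := M) (endpoint p)].
Proof.
move=> ox; have [m [m0 ml mW]] := germ_in ox erefl.
have [s sg _] := germ_meet m0 ml m0 ml.
have /chart_vpoint := germ_range m0 ml sg; apply; exact: mW s sg.
Qed.

Variable N : model R X.

Definition half_edge (e : edge N) (m : R) (b : bool) : set X :=
  chart e @` (if b then [set t | (m%:E < t < len e)%E] else [set t | (0 < t < m%:E)%E]).

(** Once [e] is split at the parameter [m], the space minus the vertices and the
    splitting point is a disjoint union of open intervals. One half of [e] is
    taken as one part of the cut, all other intervals as the other part. *)
Lemma cut_at (e : edge N) m b (x : X) : 0 < m -> (m%:E < len e)%E ->
  (x = chart e m%:E \/ exists v, x = vpoint (m := N) v) ->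
  (forall U, open U -> U x -> U `&` half_edge e m b !=set0) ->
  (forall U, open U -> U x -> U `&` half_edge e m (~~ b) !=set0 \/
     exists2 e' : edge N, e' != e & U `&` chart e' @` [set t | (0 < t < len e')%E] !=set0) ->
  locally_cut x.
Proof.
move=> m0 ml xE accA accB.
have m0' : (0 < m%:E)%E by rewrite lte_fin.
pose B := half_edge e m (~~ b) `|`
  \bigcup_(e' in [set e' : edge N | e' != e]) (chart e' @` [set t | (0 < t < len e')%E]).
have o_half c : open (half_edge e m c).
  by rewrite /half_edge; case: c; apply: open_interval; rewrite ?(ltW m0') ?(ltW ml).
have half_in c y : half_edge e m c y ->
    exists t, [/\ (0 < t < len e)%E, t <> m%:E, (m%:E < t)%E = c & y = chart e t].
  rewrite /half_edge; case: c => -[t /andP[t1 t2] <-]; exists t; split=> //.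
  - by rewrite t2 (lt_trans m0').
  - by move=> E; rewrite E ltxx in t1.
  - by rewrite t1 (lt_trans t2).
  - by move=> E; rewrite E ltxx in t2.
  - by rewrite ltNge (ltW t2).
have in_half t : (0 < t < len e)%E -> t <> m%:E ->
    half_edge e m (m%:E < t)%E (chart e t).
  move=> /andP[t0 tl] /eqP tm; rewrite /half_edge; case: ifP => mt; exists t => //=.
    by rewrite mt.
  by rewrite t0 lt_neqAle tm leNgt mt.
have inter e' t : (0 < t < len e')%E -> (e' = e -> t <> m%:E) ->
    half_edge e m b (chart e' t) \/ B (chart e' t).
  move=> te' tm; have [E|Ne] := eqVneq e' e; last by right; right; exists e' => //; exists t.
  subst e'; have := in_half t te' (tm erefl).
  by rewrite /B; case: (_ < _)%E; case: (b) => H; [left|right; left|right; left|left].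
have notx e' t : (0 < t < len e')%E -> (e' = e -> t <> m%:E) -> chart e' t <> x.
  move=> te' tm; case: xE => [->|[v ->]]; last exact: chart_vpoint.
  move=> /chart_inj; rewrite te' m0' ml => /(_ isT isT)[E1 E2]; exact: tm.
have oB : open B.
  apply: openU; first exact: o_half.
  by apply: bigcup_open => e' _; apply: open_interval.
have Bx y : B y -> y <> x.
  case=> [/half_in[t [te tm _ ->]]|[e' /= Ne [t te <-]]].
    by apply: notx => // _.
  by apply: notx => // E; rewrite E eqxx in Ne.
exists (half_edge e m b), B; split => //.
- move=> y [/half_in[t [te tm tb ->]]].
  case=> [/half_in[t' [te' tm' tb' /(chart_inj te te')[_ E]]]|].
    by move: tb'; rewrite -E tb; case: (b).
  case=> e' /= Ne [t' te' /(chart_inj te' te)[E _]].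
  by rewrite E eqxx in Ne.
- apply/(open_chart N) => e' t te'.
  case=> [[/= tx|tA]|tB].
  (* near [x] the chart meets no vertex or splitting point other than [x] *)
  + have avoid (a : \bar R) : \forall s \near t, s = t \/ s <> a.
      have [->|/eqP ta] := eqVneq t a.
        by near=> s; have [->|/eqP] := eqVneq s a; [left|right].
      by apply: filterS (near_neq ta); right.
    have A0 := avoid 0%E; have Al := avoid (len e'); have Am := avoid m%:E.
    near=> s => /andP[s0 sl].
    have [st|s0'] : s = t \/ s <> 0%E by near: s.
      by left; left; rewrite st.
    have [st|sl'] : s = t \/ s <> len e' by near: s.
      by left; left; rewrite st.
    have [st|sm'] : s = t \/ s <> m%:E by near: s.
      by left; left; rewrite st.
    have [] := @inter e' s; [|by move=> _|by left; right|by right].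
    by rewrite !lt_neqAle s0 sl eq_sym; move/eqP: s0' => ->; move/eqP: sl' => ->.
  + apply: filterS (chart_near (o_half b) te' tA) => s H /H; by left; right.
  + apply: filterS (chart_near oB te' tB) => s H /H; by right.
- split; first by case/half_in => t [te tm _ /esym]; apply: notx => // _.
  split; first by move=> /Bx.
  move=> U oU Ux; split; first exact: accA.
  have [[y [Uy Hy]]|[e' Ne [y [Uy Hy]]]] := accB U oU Ux.
    by exists y; split=> //; left.
  by exists y; split=> //; right; exists e'.
Unshelve. all: by end_near. Qed.

Lemma germ_half p m m' : 0 < m -> (m%:E < len p.1)%E -> 0 < m' -> (m'%:E < len p.1)%E ->
  exists2 s, germ p m s & half_edge p.1 m' p.2 (chart p.1 s%:E).
Proof.
move=> m0 ml m'0 m'l; have [s sg sg'] := germ_meet m0 ml m'0 m'l.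
exists s => //; move: sg'; rewrite /half_edge /germ; case: ifP => _ /= [A B];
  exists s%:E => //; by rewrite lte_fin A.
Qed.

(** At an inner point of an edge the two halves of the edge form a cut; at a
    vertex of valence at least two, one edge end is opposed to all others. *)
Lemma not_leaf_cut (x : X) :
  (exists2 p : edge N * bool, leaf_end (endpoint p) & x = vpoint (m := N) (endpoint p)) \/
  open [set x] \/ locally_cut x.
Proof.
have [[v xv]|[e [t te xE]]] := model_surj N x; last first.
  right; right.
  have tr : t \is a fin_num.
    by case/andP: te => t0 tl; rewrite gt0_fin_numE // (lt_le_trans tl) // leey.
  rewrite -(fineK tr) in te xE; set m := fine t in te xE.
  have /andP[m0' ml] := te; have m0 : 0 < m by rewrite -lte_fin.
  have acc c U : open U -> U x -> U `&` half_edge e m c !=set0.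
    move=> oU; rewrite xE => /(chart_near oU); rewrite !ltW // => /(_ isT) H.
    case: c.
      have [m' [mm' m'l H']] := near_right H ml.
      have [|s ms] := @real_between _ m m'%:E; first by rewrite lte_fin.
      rewrite lte_fin => sm'.
      exists (chart e s%:E); split.
        apply: H' => //; first exact: ltW.
        by rewrite lee_fin (ltW (lt_trans m0 ms)) ltW // (lt_trans _ m'l).
      by exists s%:E => //=; rewrite lte_fin ms (lt_trans _ m'l).
    have [m' [m'0 m'm H']] := near_left H m0'.
    have [s ms sm'] := real_between m'm.
    exists (chart e s%:E); split.
      apply: H' => //; first exact: ltW.
      by rewrite lee_fin (ltW (lt_trans m'0 ms)) ltW // (lt_trans sm').
    by exists s%:E => //=; rewrite lte_fin (lt_trans m'0 ms).
  apply: (@cut_at e m true) => //; first by left.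
  - exact: acc.
  - by move=> U oU Ux; left; apply: acc.
have [p0|] := set_0Vmem (ends v).
  right; left; apply/(open_chart N) => e t te' /= tx.
  have Nv q : endpoint q <> v.
    move=> E; have : q \in ends v by rewrite inE E.
    by rewrite p0 inE.
  have [t0|t0] := eqVneq t 0%E.
    move: tx; rewrite t0 chart_src xv => /(@vpoint_inj _ _ N) E.
    by case: (Nv (e, false)).
  have [tl|tl] := eqVneq t (len e).
    move: tx; rewrite tl chart_tgt xv => /(@vpoint_inj _ _ N) E.
    by case: (Nv (e, true)).
  have : (0 < t < len e)%E by rewrite !lt_neqAle eq_sym t0 tl.
  by move=> /chart_vpoint; rewrite tx xv => /(_ v).
case=> p; rewrite inE => /eqP pv; have [leafv|] := boolP (leaf_end v).
  by left; exists p; rewrite pv.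
rewrite /leaf_end -card_ends => card_v; right; right.
have : (1 < #|ends v|)%N.
  by rewrite ltn_neqAle eq_sym card_v; apply/card_gt0P; exists p; rewrite inE pv.
case/card_gt1P => {p pv}p [q []]; rewrite !inE => /eqP pv /eqP qv pq.
have [m m0 ml] := real_between (len_gt0 p.1).
apply: (@cut_at p.1 m p.2) => //; first by right; exists v.
  move=> U oU; rewrite xv -pv => /(germ_in oU)[m' [m'0 m'l H]].
  have [s sg sh] := germ_half m'0 m'l m0 ml.
  by exists (chart p.1 s%:E); split=> //; apply: H.
move=> U oU; rewrite xv -qv => /(germ_in oU)[m' [m'0 m'l H]].
have [E|Ne] := eqVneq q.1 p.1; [left|right].
  have q2 : q.2 = ~~ p.2.
    by move: pq; case: p q E {pv qv m m0 ml m' m'0 m'l H} => e [] [e' []] /= ->; rewrite ?eqxx.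
  rewrite -E in ml *; rewrite -q2.
  have [s sg sh] := germ_half m'0 m'l m0 ml.
  by exists (chart q.1 s%:E); split=> //; apply: H.
exists q.1 => //; have [s sg _] := germ_meet m'0 m'l m'0 m'l.
exists (chart q.1 s%:E); split; first exact: H.
by exists s%:E => //; apply: germ_range sg.
Qed.

End LocalCut.

(** Being a leaf end excludes being isolated or a local cut point, and these are
    the only alternatives in another model; so leaf ends of one model are leaf
    ends of every other. *)
Lemma leaf_ends_le (R : realType) (X : topologicalType) (M N : model R X) :
  (#|leaf_ends M| <= #|leaf_ends N|)%N.
Proof.
have H v : leaf_end v -> exists2 w : vertex N, leaf_end w & vpoint (m := N) w = vpoint (m := M) v.
  move=> leafv; have : (0 < #|ends v|)%N by rewrite card_ends; move: leafv => /eqP->.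
  case/card_gt0P => p; rewrite inE => /eqP pv.
  have [[q leafq qE]|[|]] := not_leaf_cut N (vpoint (m := M) v).
  - by exists (endpoint q).
  - by rewrite -pv => /leaf_not_isolated.
  - by rewrite -pv => /leaf_not_cut; rewrite pv.
have [w0 _] : exists w : vertex N, true.
  by have /card_gt0P[w _] := multigraph_nonempty N; exists w.
have /choice[f fP] : forall v : vertex M, exists w : vertex N, leaf_end v ->
    leaf_end w /\ vpoint (m := N) w = vpoint (m := M) v.
  move=> v; have [/H[w]|] := boolP (leaf_end v); last by exists w0.
  by exists w.
rewrite -(@card_in_imset _ _ f).
  apply/subset_leq_card/fintype.subsetP => w /imsetP[v]; rewrite !inE => /fP[] leafw _ ->.
  exact: leafw.
move=> v w; rewrite !inE => /fP[_ Ev] /fP[_ Ew] E.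
by apply: (@vpoint_inj _ _ M); rewrite -Ev -Ew E.
Qed.

(** * Piecewise affine functions of one variable and their germs *)

Section AffinePieces.
Variable R : realType.
Implicit Types (phi : \bar R -> \bar R) (D : R -> Prop).

Definition affine_on D phi := exists (m : int) (q : R),
  forall t, D t -> phi t%:E = (m%:~R * t + q)%:E.

Lemma affine_onS D D' phi : (forall t, D' t -> D t) -> affine_on D phi -> affine_on D' phi.
Proof. by move=> DD' [m [q H]]; exists m, q => t /DD'/H. Qed.

(** Consecutive pieces along [x :: s] as a recursive predicate, suited to
    induction on the list of breakpoints. *)
Fixpoint affine_pieces phi (x : \bar R) s : Prop :=
  if s is y :: s' then
    [/\ (x < y)%E, affine_on (fun t => (x <= t%:E <= y)%E) phi & affine_pieces phi y s']
  else True.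

Lemma affine_piecesP phi x s :
  (path <%O x s /\ forall i, (i < size s)%N -> exists (m : int) (q : R), forall t : R,
     (nth 0%E (x :: s) i <= t%:E <= nth 0%E (x :: s) i.+1)%E ->
     phi t%:E = (m%:~R * t + q)%:E) <-> affine_pieces phi x s.
Proof.
elim: s x => [|y s IHs] x //=; split.
  move=> [/andP[xy ys] H]; split=> //; first exact: (H 0%N).
  by apply/IHs; split=> // i; apply: (H i.+1).
move=> [xy A /IHs[ys H]]; split; first by rewrite xy.
by case=> [|i] // si; apply: H.
Qed.

Lemma affine_pieces_rcons phi x s y : affine_pieces phi x s -> (last x s < y)%E ->
  affine_on (fun t => (last x s <= t%:E <= y)%E) phi -> affine_pieces phi x (rcons s y).
Proof. by elim: s x => //= z s IHs x [xz A H] zy B; split=> //; apply: IHs. Qed.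

Lemma affine_pieces_right phi x s (t : R) : affine_pieces phi x s ->
  (x <= t%:E)%E -> (t%:E < last x s)%E ->
  exists2 K : \bar R, (t%:E < K)%E & affine_on (fun z => (t%:E <= z%:E <= K)%E) phi.
Proof.
elim: s x => [|y s IHs] x /=; first by move=> _ /le_lt_trans/[apply]; rewrite ltxx.
move=> [xy A H] xt tl; have [ty|/IHs] := ltP t%:E y; last exact.
exists y => //; apply: affine_onS A => z /andP[tz ->].
by rewrite (le_trans xt).
Qed.

Lemma affine_pieces_left phi x s (t : R) : affine_pieces phi x s ->
  (x < t%:E)%E -> (t%:E <= last x s)%E ->
  exists2 K : \bar R, (K < t%:E)%E & affine_on (fun z => (K <= z%:E <= t%:E)%E) phi.
Proof.
elim: s x => [|y s IHs] x /=; first by move=> _ /lt_le_trans/[apply]; rewrite ltxx.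
move=> [xy A H] xt tl; have [|ty] := leP t%:E y; last exact: IHs tl.
by move=> ty; exists x => //; apply: affine_onS A => z /andP[-> /le_trans->].
Qed.

Lemma affine_pieces_infty phi x s : affine_pieces phi x s -> (x < +oo)%E ->
  last x s = +oo%E ->
  exists2 K : R, True & affine_on (fun z => K <= z) phi.
Proof.
elim: s x => [|y s IHs] x /=; first by move=> _ /[swap] ->.
move=> [xy A H] xt; have [yE|yoo] := eqVneq y +oo%E; last first.
  by apply: IHs; rewrite ?ltey.
rewrite yE in xy A; move=> _; case: x xy xt A {IHs H} => [r| |] // _ _ A.
  by exists r => //; apply: affine_onS A => z rz; rewrite lee_fin rz leey.
by exists 0 => //; apply: affine_onS A => z rz; rewrite leNye leey.
Qed.

(** These one-sided filters contain the point itself, so that germs along them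
    include the value there, and hence continuity. *)
Definition right_of (t : R) : set_system R := within [set s | t <= s] (nbhs t).
Definition left_of (t : R) : set_system R := within [set s | s <= t] (nbhs t).

Definition affine_germ (F : set_system R) phi := exists (m : int) (q : R),
  \forall t \near F, phi t%:E = (m%:~R * t + q)%:E.

(** At infinity no affine formula makes sense, so the value there is prescribed
    as a limit. *)
Definition locally_affine (l : \bar R) phi :=
  [/\ forall t : R, 0 <= t -> (t%:E < l)%E -> affine_germ (right_of t) phi,
      forall t : R, 0 < t -> (t%:E <= l)%E -> affine_germ (left_of t) phi &
      l = +oo%E -> affine_germ +oo phi /\ phi t%:E @[t --> +oo] --> phi +oo%E].

Global Instance right_of_proper t : ProperFilter (right_of t).
Proof. by apply: within_nbhs_proper; apply: subset_closure => /=. Qed.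

Global Instance left_of_proper t : ProperFilter (left_of t).
Proof. by apply: within_nbhs_proper; apply: subset_closure => /=. Qed.

Lemma near_right_of (P : set R) (t K : R) : t < K ->
  (forall s, t <= s -> s < K -> P s) -> \forall s \near right_of t, P s.
Proof.
move=> tK H; have B : \forall s \near t, s < K by exact: lt_nbhsl.
by apply: filterS B => s sK ts; apply: H.
Qed.

Lemma near_left_of (P : set R) (t K : R) : K < t ->
  (forall s, K < s -> s <= t -> P s) -> \forall s \near left_of t, P s.
Proof.
move=> tK H; have B : \forall s \near t, K < s by exact: lt_nbhsr.
by apply: filterS B => s sK ts; apply: H.
Qed.

Lemma right_ofP (P : set R) (t : R) : (\forall s \near right_of t, P s) ->
  exists2 K, t < K & forall s, t <= s -> s < K -> P s.
Proof.
move=> H; have /nbhs_ballP[e /= e0 eP] : nbhs t [set s | t <= s -> P s] := H.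
exists (t + e); first by rewrite ltrDl.
by move=> s ts se; apply: eP => //; rewrite /ball /= ler0_norm; lra.
Qed.

Lemma left_ofP (P : set R) (t : R) : (\forall s \near left_of t, P s) ->
  exists2 K, K < t & forall s, K < s -> s <= t -> P s.
Proof.
move=> H; have /nbhs_ballP[e /= e0 eP] : nbhs t [set s | s <= t -> P s] := H.
exists (t - e); first by rewrite gtrBl.
by move=> s ts se; apply: eP => //; rewrite /ball /= ger0_norm; lra.
Qed.

Lemma pinftyP (P : set R) : (\forall s \near +oo, P s) <-> exists K, forall s, K < s -> P s.
Proof. by split=> [[K [_ H]]|[K H]]; exists K => //; split=> //; apply: num_real. Qed.

Lemma pieces_locally_affine phi s l : affine_pieces phi 0%E s -> last 0%E s = l ->
  (l = +oo%E -> phi t%:E @[t --> +oo] --> phi +oo%E) -> locally_affine l phi.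
Proof.
move=> H sl cvgoo; split=> [t t0 tl|t t0 tl|loo].
- have [K tK [m [q A]]] := affine_pieces_right H t0 (eq_ind_r (fun z => (t%:E < z)%E) tl sl).
  exists m, q; have [K' tK' K'K] := real_between tK.
  apply: (near_right_of tK') => z tz zK; apply: A.
  by rewrite lee_fin tz ltW // (lt_trans _ K'K).
- have [||K Kt [m [q A]]] := @affine_pieces_left phi 0%E s t H; rewrite ?lte_fin ?sl //.
  have [K' [K'0]] : exists K' : R, K' < t /\ (K <= K'%:E)%E.
    case: K Kt {A} => [r| |] //; first by exists r.
    by exists (t - 1); rewrite gtrBl leNye.
  move=> KK'; exists m, q; apply: (near_left_of K'0) => z K'z zt; apply: A.
  by rewrite lee_fin zt andbT (le_trans KK') // lee_fin ltW.
- split; last exact: cvgoo.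
  have [|K _ [m [q A]]] := affine_pieces_infty H (ltry 0); first by rewrite sl.
  by exists m, q; apply/pinftyP; exists K => z Kz; apply: A; apply: ltW.
Qed.

(** The supremum of the points up to which finitely many pieces suffice is
    attained and can be passed, by the germs on its left and right. *)
Lemma locally_affine_pieces phi l : (0 < l)%E -> locally_affine l phi ->
  exists2 s, affine_pieces phi 0%E s & last 0%E s = l.
Proof.
move=> l0 [Hr Hl Hoo].
pose good (a : \bar R) := exists2 s, affine_pieces phi 0%E s & last 0%E s = a.
pose A := [set a | (0 <= a <= l)%E /\ good a].
have A0 : A 0%E by split; [rewrite lexx ltW|exists [::]].
set c := ereal_sup A.
have c0 : (0 <= c)%E by apply: ereal_sup_ubound.
have cl : (c <= l)%E by apply: ge_ereal_sup => a [/andP[]].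
have extend a b : good a -> (a < b)%E ->
    affine_on (fun t => (a <= t%:E <= b)%E) phi -> good b.
  move=> [s Hs sa] ab Hab; exists (rcons s b); last by rewrite last_rcons.
  by apply: affine_pieces_rcons; rewrite ?sa.
have gc : good c.
  have [->|cn0] := eqVneq c 0%E; first by case: A0.
  have c0' : (0 < c)%E by rewrite lt_neqAle eq_sym cn0.
  have [K Kc [m [q HK]]] : exists2 K : R, (K%:E < c)%E &
      affine_on (fun t => K < t /\ (t%:E <= c)%E) phi.
    move: (c) cl c0' => [t| |] // cl' t0.
      have [m [q /left_ofP[K Kt HK]]] := Hl t t0 cl'.
      by exists K => //; exists m, q => z []; rewrite lee_fin; apply: HK.
    have [[m [q /pinftyP[K HK]]] _] : affine_germ +oo phi /\
        phi t%:E @[t --> +oo] --> phi +oo%E.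
      by apply: Hoo; apply/eqP; rewrite eq_le leey.
    by exists K; rewrite ?ltry //; exists m, q => z []; move=> /HK.
  have [a [ale ga] Ka] := ereal_sup_gt Kc.
  have [<-//|ac] := eqVneq a c.
  have {}ac : (a < c)%E.
    by rewrite lt_neqAle ac; apply: ereal_sup_ubound.
  by apply: (extend a) => //; exists m, q => z /andP[az zc]; apply: HK; rewrite -lte_fin (lt_le_trans Ka).
have [<- //|cnl] := eqVneq c l.
have {}cl : (c < l)%E by rewrite lt_neqAle cnl.
have [r cr] : exists r, c = r%:E.
  by exists (fine c); rewrite fineK // ge0_fin_numE // (lt_le_trans cl) ?leey.
rewrite cr in c0 cl gc.
have [m [q /right_ofP[K rK HK]]] := Hr r c0 cl.
have [|b rb] := @real_between _ r (Order.min l K%:E).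
  by rewrite lt_min cl lte_fin.
rewrite lt_min => /andP[bl bK]; rewrite lte_fin in bK.
have : A b%:E.
  split; first by rewrite (ltW bl) (le_trans c0) // lee_fin ltW.
  apply: (extend r%:E) => //; exists m, q => z; rewrite !lee_fin => /andP[rz zb].
  by apply: HK => //; apply: le_lt_trans bK.
by move=> /ereal_sup_ubound; rewrite -/c cr lee_fin leNgt rb.
Qed.

(** The property that makes the maximum of two affine germs equal to one of
    them. *)
Definition sign_filter (F : set_system R) := forall (a b : R),
  (\forall t \near F, 0 <= a * t + b) \/ (\forall t \near F, a * t + b <= 0).

Lemma sign_right t : sign_filter (right_of t).
Proof.
move=> a b.
wlog a0 : a b / 0 <= a.
  move=> H; have [/H|/ltW a0] := leP 0 a; first exact.
  have := H (- a) (- b); rewrite oppr_ge0 => /(_ a0)[|] K; [right|left];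
    by apply: filterS K => s; rewrite mulNr -opprD ?oppr_ge0 ?oppr_le0.
have [t0|t0] := leP 0 (a * t + b).
  left; apply: (@near_right_of _ t (t + 1)); first by rewrite ltrDl.
  by move=> s ts _; have := ler_wpM2l a0 ts; lra.
right; have a1 : 0 < a + 1 by rewrite ltr_wpDl.
(* [a + 1] rather than [a], which may vanish *)
pose d := - (a * t + b) / (a + 1).
have d0 : 0 < d by rewrite divr_gt0 // oppr_gt0.
apply: (@near_right_of _ t (t + d)); first by rewrite ltrDl.
move=> s ts st; have : d * (a + 1) = - (a * t + b) by rewrite divfK // gt_eqF.
by have := ler_wpM2l a0 (ltW st); rewrite mulrDr; lra.
Qed.

Lemma sign_left t : sign_filter (left_of t).
Proof.
move=> a b.
wlog a0 : a b / 0 <= a.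
  move=> H; have [/H|/ltW a0] := leP 0 a; first exact.
  have := H (- a) (- b); rewrite oppr_ge0 => /(_ a0)[|] K; [right|left];
    by apply: filterS K => s; rewrite mulNr -opprD ?oppr_ge0 ?oppr_le0.
have [t0|t0] := leP (a * t + b) 0.
  right; apply: (@near_left_of _ t (t - 1)); first by rewrite gtrBl.
  by move=> s _ st; have := ler_wpM2l a0 st; lra.
left; have a1 : 0 < a + 1 by rewrite ltr_wpDl.
pose d := (a * t + b) / (a + 1).
have d0 : 0 < d by rewrite divr_gt0.
apply: (@near_left_of _ t (t - d)); first by rewrite gtrBl.
move=> s ts st; have : d * (a + 1) = (a * t + b) by rewrite divfK // gt_eqF.
by have := ler_wpM2l a0 (ltW ts); rewrite mulrBr; lra.
Qed.

Lemma sign_infty : sign_filter (+oo : set_system R).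
Proof.
move=> a b.
wlog a0 : a b / 0 <= a.
  move=> H; have [/H|/ltW a0] := leP 0 a; first exact.
  have := H (- a) (- b); rewrite oppr_ge0 => /(_ a0)[|] K; [right|left];
    by apply: filterS K => s; rewrite mulNr -opprD ?oppr_ge0 ?oppr_le0.
have [->|an0] := eqVneq a 0.
  by have [b0|/ltW b0] := leP 0 b; [left|right]; near=> s; rewrite mul0r add0r.
have {}a0 : 0 < a by rewrite lt_neqAle eq_sym an0.
left; apply/pinftyP; exists (- b / a) => s; rewrite ltr_pdivrMr // => H; lra.
Unshelve. all: by end_near. Qed.

Lemma eq_germ F phi psi : Filter F -> (\forall t \near F, psi t%:E = phi t%:E) ->
  affine_germ F phi -> affine_germ F psi.
Proof.
move=> FF E [m [q A]]; exists m, q; near=> t.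
by rewrite (near E) // (near A).
Unshelve. all: by end_near. Qed.

Lemma germ_add F phi psi : Filter F -> affine_germ F phi -> affine_germ F psi ->
  affine_germ F (fun t => phi t + psi t)%E.
Proof.
move=> FF [m [q A]] [m' [q' A']]; exists (m + m'), (q + q'); near=> t.
by rewrite (near A) // (near A') // -EFinD; congr EFin; rewrite intrD; ring.
Unshelve. all: by end_near. Qed.

Lemma germ_opp F phi : Filter F -> affine_germ F phi -> affine_germ F (fun t => - phi t)%E.
Proof.
move=> FF [m [q A]]; exists (- m), (- q); near=> t.
by rewrite (near A) // -EFinN; congr EFin; rewrite mulrNz; ring.
Unshelve. all: by end_near. Qed.

Lemma germ_le F phi psi : Filter F -> sign_filter F -> affine_germ F phi ->
  affine_germ F psi -> (\forall t \near F, phi t%:E <= psi t%:E)%E \/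
                       (\forall t \near F, psi t%:E <= phi t%:E)%E.
Proof.
move=> FF SF [m [q A]] [m' [q' A']].
have [H|H] := SF (m'%:~R - m%:~R) (q' - q); [left|right]; near=> t;
  rewrite (near A) // (near A') // lee_fin -subr_ge0.
  have -> : m'%:~R * t + q' - (m%:~R * t + q) = (m'%:~R - m%:~R) * t + (q' - q) by ring.
  by near: t.
have -> : m%:~R * t + q - (m'%:~R * t + q') = - ((m'%:~R - m%:~R) * t + (q' - q)) by ring.
by rewrite oppr_ge0; near: t.
Unshelve. all: by end_near. Qed.

Lemma germ_max F phi psi : Filter F -> sign_filter F -> affine_germ F phi ->
  affine_germ F psi -> affine_germ F (fun t => Order.max (phi t) (psi t)).
Proof.
move=> FF SF Hphi Hpsi; have [H|H] := germ_le FF SF Hphi Hpsi.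
  by apply: (eq_germ FF _ Hpsi); near=> t; apply/max_idPr; exact: (near H).
by apply: (eq_germ FF _ Hphi); near=> t; apply/max_idPl; exact: (near H).
Unshelve. all: by end_near. Qed.

Lemma germ_const F (c : R) : Filter F -> affine_germ F (cst c%:E).
Proof. by move=> FF; exists 0, c; near=> t; rewrite mul0r add0r. 
Unshelve. all: by end_near. Qed.

Lemma germ_id F : Filter F -> affine_germ F id.
Proof. by move=> FF; exists 1, 0; near=> t; rewrite mul1r addr0. 
Unshelve. all: by end_near. Qed.

Lemma germ_cvg_infty phi : affine_germ +oo phi -> cvg (phi t%:E @[t --> +oo]).
Proof.
move=> [m [q A]].
suff [l H] : exists l : \bar R, (m%:~R * t + q)%:E @[t --> +oo] --> l.
  apply/cvg_ex; exists l; apply: cvg_trans H; apply: near_eq_cvg.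
  by apply: filterS A => t ->.
have pos (a b : R) : 0 < a -> (a * t + b)%:E @[t --> +oo] --> +oo%E.
  move=> a0; apply/cvgeyPge => B; apply/pinftyP; exists ((B - b) / a) => t.
  by rewrite ltr_pdivrMr // lee_fin; lra.
have [m0|m0|->] := ltrgtP (m%:~R : R) 0.
- exists (-oo)%E; apply/cvgeNP; rewrite /=.
  have := pos (- m%:~R) (- q); rewrite oppr_gt0 => /(_ m0); apply: cvg_trans.
  by apply: near_eq_cvg; near=> t; congr EFin; ring.
- by exists +oo%E; apply: pos.
- by exists q%:E; apply: cvg_near_cst; near=> t; rewrite mul0r add0r.
Unshelve. all: by end_near. Qed.

Lemma germ_continuous F (t : R) phi (W : set (\bar R)) : Filter F -> F `=>` nbhs t ->
  (forall P : set R, (\forall s \near F, P s) -> P t) ->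
  affine_germ F phi -> open W -> W (phi t%:E) -> \forall s \near F, W (phi s%:E).
Proof.
move=> FF Ft at_t [m [q A]] oW; rewrite (at_t _ A) => Wt.
have : \forall s \near t, W (m%:~R * s + q)%:E.
  have : continuous (fun s : R => (m%:~R * s + q)%:E).
    move=> s; apply: cvg_EFin; first by near=> z.
    apply: cvgD; last exact: cvg_cst.
    by apply: cvgM; [exact: cvg_cst|exact: cvg_id].
  by move=> /(_ t); apply; apply: open_nbhs_nbhs.
move=> /Ft B; near=> s; rewrite (near A) //; exact: (near B).
Unshelve. all: by end_near. Qed.

Lemma locally_affine_near l phi (t : \bar R) (W : set (\bar R)) : locally_affine l phi ->
  (0 <= t <= l)%E -> open W -> W (phi t) ->
  \forall s \near t, (0 <= s <= l)%E -> W (phi s).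
Proof.
move=> [Hr Hl Hoo] /andP[]; case: t => [t| |] // t0 tl oW Wt.
  have right_s : \forall s \near t, t <= s -> (s%:E <= l)%E -> W (phi s%:E).
    move: tl; rewrite le_eqVlt => /orP[/eqP<-|tl].
      near=> s => ts; rewrite lee_fin => st.
      by have <- : t = s by apply/eqP; rewrite eq_le ts st.
    have H : \forall s \near right_of t, W (phi s%:E).
      apply: (germ_continuous _ _ _ (Hr t t0 tl) oW Wt); first exact: cvg_within.
      by move=> P /nbhs_singleton; apply => /=.
    have {}H : nbhs t [set s | t <= s -> W (phi s%:E)] := H.
    by apply: filterS H => s /= Hs ts _; apply: Hs.
  have left_s : \forall s \near t, s <= t -> 0 <= s -> W (phi s%:E).
    move: t0; rewrite lee_fin le_eqVlt => /orP[/eqP t0|t0].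
      near=> s => st s0; suff <- : t = s by [].
      by apply/eqP; rewrite eq_le st -t0 s0.
    have H : \forall s \near left_of t, W (phi s%:E).
      apply: (germ_continuous _ _ _ (Hl t t0 tl) oW Wt); first exact: cvg_within.
      by move=> P /nbhs_singleton; apply => /=.
    have {}H : nbhs t [set s | s <= t -> W (phi s%:E)] := H.
    by apply: filterS H => s /= Hs st _; apply: Hs.
  have : \forall s \near t, (0 <= s%:E <= l)%E -> W (phi s%:E).
    near=> s => /andP[s0 sl]; have [ts|/ltW st] := leP t s.
      by move: sl; move: ts; near: s.
    by move: s0; rewrite lee_fin; move: st; near: s.
  by [].
have loo : l = +oo%E by apply/eqP; rewrite -leye_eq.
have [_ /(_ W)] := Hoo loo.
have Woo : nbhs (phi +oo%E) W by apply: open_nbhs_nbhs.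
move=> /(_ Woo) /pinftyP[K H]; exists K; split; first exact: num_real.
by case=> [s| |] //; rewrite lte_fin => /H.
Unshelve. all: by end_near. Qed.

End AffinePieces.

(** * The semifield of rational functions *)

Section RationalFunctions.
Variables (R : realType) (T : tropicalCurve R).
Local Notation M := (curve_model T).
Implicit Types (f g : T -> \bar R) (e : edge M) (x : T) (t : R).

Lemma chart_finite e t : 0 <= t -> (t%:E <= len e)%E -> ~ at_infinity (chart e t%:E).
Proof.
move=> t0 tl [e' e'oo]; rewrite -e'oo chart_tgt.
have leaf' := len_infty_tgt e'oo.
have [tn0|tn0] := eqVneq t 0.
  rewrite tn0 chart_src => /(@vpoint_inj _ _ M) E.
  by have := @leaf_end_unique M (e', true) (e, false) leaf' (esym E).
have [tnl|tnl] := eqVneq t%:E (len e).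
  rewrite tnl chart_tgt => /(@vpoint_inj _ _ M) E.
  have [E'] := @leaf_end_unique M (e', true) (e, true) leaf' (esym E).
  by move: tnl; rewrite -E' e'oo.
have : (0 < t%:E < len e)%E by rewrite !lt_neqAle tl tnl lee_fin t0 eqe eq_sym tn0.
by move=> /chart_vpoint; apply.
Qed.

Lemma infinity_end e : len e = +oo%E -> chart e +oo%E = vpoint (m := M) (endpoint (e, true)).
Proof. by move=> eoo; rewrite -(chart_end (e, true)) /end_param /= eoo. Qed.

(** The end of an infinite edge is a leaf end, so its punctured neighbourhoods
    are final parts of a single ray. *)
Lemma near_infinity e (P : set T) : len e = +oo%E ->
  (\forall t \near +oo, P (chart e t%:E)) -> \forall y \near (chart e +oo%E)^', P y.
Proof.
move=> eoo /pinftyP[K H].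
have leafe := @len_infty_tgt _ _ M e eoo.
have [m0 mK] : 0 < Num.max K 1 /\ K <= Num.max K 1.
  by rewrite lt_max ltr01 orbT le_max lexx.
have ml : ((Num.max K 1)%:E < len e)%E by rewrite eoo ltry.
have oU := @star_open _ _ M (e, true) _ leafe m0 ml.
rewrite /dnbhs infinity_end // /within /=.
have /open_nbhs_nbhs : open_nbhs (vpoint (m := M) (endpoint (e, true)))
  ([set vpoint (m := M) (endpoint (e, true))] `|` chart e @` (EFin @` germ (e, true) (Num.max K 1))).
  by split=> //; left.
apply: filterS => y [/= ->|[_ [s [ms _] <-] <-] _]; first by rewrite eqxx.
by apply: H; apply: le_lt_trans ms.
Qed.

Lemma infinity_proper e : len e = +oo%E -> ProperFilter (chart e +oo%E)^'.
Proof.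
move=> eoo; apply: Build_ProperFilter_ex.
move=> P; rewrite /dnbhs /within /= => /nbhs_interior; rewrite infinity_end //.
set x := vpoint _ => Px; set Q := interior _ in Px.
have oQ : open Q by exact: open_interior.
have [m [m0 ml H]] := germ_in oQ (nbhs_singleton Px).
have [s sg _] := germ_meet m0 ml m0 ml.
have /interior_subset /= Ps := H s sg.
exists (chart e s%:E); apply: Ps; apply/eqP => E.
by have /chart_vpoint := germ_range m0 ml sg; move/(_ _ E).
Qed.

Lemma infinity_cvg e f (l : \bar R) : len e = +oo%E ->
  f (chart e t%:E) @[t --> +oo] --> l -> f @ (chart e +oo%E)^' --> l.
Proof. by move=> eoo H W Wl; apply: near_infinity => //; apply: H. Qed.

(** The nonzero rational functions. Describing them by germs instead of lists of
    breakpoints makes sums and maxima straightforward. *)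
Definition PL f : Prop := (forall e, locally_affine (len e) (f \o chart e)) /\
  forall x, ~ at_infinity x -> f x \is a fin_num.

Lemma chart_cvg_infty f e : continuous f -> len e = +oo%E ->
  f (chart e t%:E) @[t --> +oo] --> f (chart e +oo%E).
Proof.
move=> fc eoo W; rewrite nbhsE => -[V [oV Vf] VW].
have oU : open (f @^-1` V) by apply: open_comp => // y _; apply: fc.
have : \forall s \near +oo%E, (0 <= s <= len e)%E -> (f @^-1` V) (chart e s).
  by apply: chart_near => //; rewrite eoo leey.
move=> [K [_ HK]]; apply/pinftyP; exists (Num.max K 0) => s.
rewrite gt_max => /andP[Ks s0]; apply: VW; apply: HK; rewrite ?lte_fin //.
by rewrite lee_fin ltW // eoo leey.
Qed.

Lemma PL_continuous f : PL f -> continuous f.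
Proof.
move=> [fe _]; apply/continuousP => W oW; apply/(open_chart M) => e t te Wt.
exact: locally_affine_near (fe e) te oW Wt.
Qed.

Lemma rational_PL f : Defs.rational f <-> f = @trop0 R T \/ PL f.
Proof.
split=> [[->|[fc fp fi]]|[->|fP]]; [by left|right|by left|right].
  split=> [e|x xf].
    have [s [ss sl sp]] := fp e.
    apply: pieces_locally_affine sl _; first by apply/affine_piecesP.
    by move=> eoo; apply: chart_cvg_infty.
  by case: (f x) (fi x) => [r //| |] H; case: xf; apply: H; [left|right].
split; first exact: PL_continuous.
- move=> e; have [s Hs sl] := locally_affine_pieces (len_gt0 e) (fP.1 e).
  by have [ss sp] := (affine_piecesP _ _ _).2 Hs; exists s.
- move=> x fx; apply: contrapT => xf; have := fP.2 x xf.
  by case: fx => ->.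
Qed.

Lemma PL_rational f : PL f -> Defs.rational f.
Proof. by move=> ?; apply/rational_PL; right. Qed.

(** Points at infinity are limits of finite points. *)
Lemma PL_ext f g : PL f -> PL g -> (forall x, ~ at_infinity x -> f x = g x) -> f = g.
Proof.
move=> fP gP fg; apply/funext => x; have [|/fg//] := pselect (at_infinity x).
case=> e eoo ->; have fc := chart_cvg_infty (PL_continuous fP) eoo.
have gc := chart_cvg_infty (PL_continuous gP) eoo.
apply: (cvg_unique _ fc); first exact: ereal_hausdorff.
apply: cvg_trans gc; apply: near_eq_cvg; apply/pinftyP; exists 0 => s s0.
by rewrite fg //; apply: chart_finite; [exact: ltW|rewrite eoo leey].
Qed.

Lemma near_right_finite (l : \bar R) t : 0 <= t -> (t%:E < l)%E ->
  \forall s \near right_of t, 0 <= s /\ (s%:E <= l)%E.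
Proof.
move=> t0 tl; have [K tK Kl] := real_between tl.
apply: (near_right_of tK) => s ts sK; split; first exact: le_trans ts.
by rewrite ltW // (lt_trans _ Kl).
Qed.

Lemma near_left_finite (l : \bar R) t : 0 < t -> (t%:E <= l)%E ->
  \forall s \near left_of t, 0 <= s /\ (s%:E <= l)%E.
Proof.
move=> t0 tl; apply: (near_left_of t0) => s s0 st; split; first exact: ltW.
by rewrite (le_trans _ tl).
Qed.

Lemma near_infty_finite (l : \bar R) : l = +oo%E ->
  \forall s \near +oo, (0:R) <= s /\ (s%:E <= l)%E.
Proof. by move=> ->; apply/pinftyP; exists 0 => s s0; rewrite ltW // leey. Qed.

Lemma PL_add f g : PL f -> PL g -> PL (trop_add f g).
Proof.
move=> fP gP; split=> [e|x xf]; last first.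
  by rewrite /trop_add; case: leP => _; [apply: gP.2|apply: fP.2].
have [fr fl foo] := fP.1 e; have [gr gl goo] := gP.1 e; split.
- move=> t t0 tl; apply: germ_max; [exact: sign_right|exact: fr|exact: gr].
- move=> t t0 tl; apply: germ_max; [exact: sign_left|exact: fl|exact: gl].
move=> eoo; have [fg fc] := foo eoo; have [gg gc] := goo eoo.
split; first by apply: germ_max => //; apply: sign_infty.
have [H|H] := germ_le _ (@sign_infty R) fg gg.
  rewrite /= /trop_add (max_idPr _); last exact: lee_cvg_to fc gc H.
  by apply: cvg_trans gc; apply: near_eq_cvg; apply: filterS H => s /max_idPr.
rewrite /= /trop_add (max_idPl _); last exact: lee_cvg_to gc fc H.
by apply: cvg_trans fc; apply: near_eq_cvg; apply: filterS H => s /max_idPl.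
Qed.

Lemma trop_mul_finite f g x : ~ at_infinity x -> trop_mul f g x = (f x + g x)%E.
Proof. by rewrite /trop_mul => /asboolPn/negPf->. Qed.

(** The sum of two affine germs is again affine, so it has a limit even when the
    summands tend to opposite infinities. *)
Lemma trop_mul_infinity f g e : PL f -> PL g -> len e = +oo%E ->
  (f (chart e t%:E) + g (chart e t%:E))%E @[t --> +oo] --> trop_mul f g (chart e +oo%E).
Proof.
move=> fP gP eoo.
have /cvg_ex[l H] : cvg ((f (chart e t%:E) + g (chart e t%:E))%E @[t --> +oo]).
  have [_ _ /(_ eoo)[fg _]] := fP.1 e; have [_ _ /(_ eoo)[gg _]] := gP.1 e.
  exact: (germ_cvg_infty (germ_add _ fg gg)).
have xoo : at_infinity (chart e +oo%E) by exists e.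
rewrite /trop_mul asboolT //.
have := @infinity_cvg e (fun y => f y + g y)%E l eoo H.
by move=> /(@cvg_lim _ (@ereal_hausdorff R) _ _ (infinity_proper eoo)) ->.
Qed.

Lemma PL_mul f g : PL f -> PL g -> PL (trop_mul f g).
Proof.
move=> fP gP; split=> [e|x xf]; last first.
  by rewrite trop_mul_finite // fin_numD fP.2 // gP.2.
have eqfin s : 0 <= s /\ (s%:E <= len e)%E ->
    trop_mul f g (chart e s%:E) = (f (chart e s%:E) + g (chart e s%:E))%E.
  by move=> [s0 sl]; rewrite trop_mul_finite //; apply: chart_finite.
have [fr fl foo] := fP.1 e; have [gr gl goo] := gP.1 e; split.
- move=> t t0 tl; apply: (eq_germ _ _ (germ_add _ (fr t t0 tl) (gr t t0 tl))).
  by apply: filterS (near_right_finite t0 tl) => s /eqfin.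
- move=> t t0 tl; apply: (eq_germ _ _ (germ_add _ (fl t t0 tl) (gl t t0 tl))).
  by apply: filterS (near_left_finite t0 tl) => s /eqfin.
move=> eoo; have [fg fc] := foo eoo; have [gg gc] := goo eoo.
have eq_oo : \forall s \near +oo, trop_mul f g (chart e s%:E) =
    (f (chart e s%:E) + g (chart e s%:E))%E.
  by apply: filterS (near_infty_finite eoo) => s /eqfin.
split; first exact: (eq_germ _ eq_oo (germ_add _ fg gg)).
apply: cvg_trans (trop_mul_infinity fP gP eoo); apply: near_eq_cvg.
by apply: filterS eq_oo => s /= ->.
Qed.

Lemma PL_opp f : PL f -> PL (fun x => - f x)%E.
Proof.
move=> fP; split=> [e|x xf]; last by rewrite fin_numN fP.2.
have [fr fl foo] := fP.1 e; split.
- by move=> t t0 tl; apply: germ_opp; apply: fr.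
- by move=> t t0 tl; apply: germ_opp; apply: fl.
by move=> /foo[fg fc]; split; [exact: germ_opp|exact: cvgeN].
Qed.

Lemma PL_cst (c : R) : PL (cst c%:E).
Proof.
split=> // e; split.
- by move=> t t0 tl; apply: germ_const.
- by move=> t t0 tl; apply: germ_const.
by move=> _; split; [exact: germ_const|exact: cvg_cst].
Qed.

Lemma trop_mul0l f : trop_mul (@trop0 R T) f = @trop0 R T.
Proof.
apply/funext => x; have [[e eoo ->]|xf] := pselect (at_infinity x); last first.
  by rewrite trop_mul_finite // /trop0 /= addNye.
rewrite /trop_mul asboolT; last by exists e.
apply: (@cvg_lim _ (@ereal_hausdorff R) _ _ (infinity_proper eoo)).
have -> : (fun y => @trop0 R T y + f y)%E = cst -oo%E by apply/funext => y; rewrite /trop0 /= addNye.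
exact: cvg_cst.
Qed.

Lemma trop_mul0r f : trop_mul f (@trop0 R T) = @trop0 R T.
Proof.
rewrite -[RHS](trop_mul0l f) /trop_mul; apply/funext => x.
have -> : (fun y => f y + @trop0 R T y)%E = (fun y => @trop0 R T y + f y)%E.
  by apply/funext => y; rewrite addeC.
by rewrite addeC.
Qed.

Lemma trop_add0l f : trop_add (@trop0 R T) f = f.
Proof. by apply/funext => x; rewrite /trop_add /trop0 /= maxNye. Qed.

Lemma trop_add0r f : trop_add f (@trop0 R T) = f.
Proof. by apply/funext => x; rewrite /trop_add /trop0 /= maxeNy. Qed.

Lemma rational_subsemifield : subsemifield (@Defs.rational R T).
Proof.
split=> //.
- by split; [left|apply: PL_rational; apply: PL_cst].
- move=> f g /rational_PL[->|fP] gr; first by rewrite trop_add0l.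
  move/rational_PL: gr => [->|gP]; first by rewrite trop_add0r; apply: PL_rational.
  by apply: PL_rational; apply: PL_add.
- move=> f g /rational_PL[->|fP] gr; first by rewrite trop_mul0l; left.
  move/rational_PL: gr => [->|gP]; first by rewrite trop_mul0r; left.
  by apply: PL_rational; apply: PL_mul.
Qed.

(** Real-valued functions, whose values at infinity are irrelevant, stand for
    rational functions: sums, differences and maxima are then the ordinary ones
    and raise no question of definedness. *)
Definition represents (A : set (T -> \bar R)) (r : T -> R) : Prop :=
  exists f, [/\ A f, PL f & forall x, ~ at_infinity x -> f x = (r x)%:E].

Section Subsemifield.
Variable A : set (T -> \bar R).
Hypothesis subA : subsemifield A.
Implicit Types r : T -> R.

Lemma represents_mem f r : PL f -> represents A r ->
  (forall x, ~ at_infinity x -> f x = (r x)%:E) -> A f.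
Proof.
move=> fP [g [Ag gP gr]] fr.
by rewrite (@PL_ext f g) // => x xf; rewrite fr // gr.
Qed.

Lemma eq_represents r r' : (forall x, ~ at_infinity x -> r x = r' x) ->
  represents A r -> represents A r'.
Proof. by move=> rr' [f [? ? fr]]; exists f; split=> // x xf; rewrite fr // rr'. Qed.

Lemma represents_add r r' : represents A r -> represents A r' ->
  represents A (fun x => r x + r' x).
Proof.
have [_ _ _ mulA _] := subA.
move=> [f [Af fP fr]] [g [Ag gP gr]]; exists (trop_mul f g); split.
- exact: mulA.
- exact: PL_mul.
- by move=> x xf; rewrite trop_mul_finite // fr // gr.
Qed.

Lemma represents_max r r' : represents A r -> represents A r' ->
  represents A (fun x => Num.max (r x) (r' x)).
Proof.
have [_ _ addA _ _] := subA.
move=> [f [Af fP fr]] [g [Ag gP gr]]; exists (trop_add f g); split.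
- exact: addA.
- exact: PL_add.
- by move=> x xf; rewrite /trop_add fr // gr // EFin_max.
Qed.

Lemma represents_opp r : represents A r -> represents A (fun x => - r x).
Proof.
have [_ _ _ _ invA] := subA.
move=> [f [Af fP fr]]; exists (fun x => - f x)%E; split.
- apply: (invA f) => //; first by apply: PL_rational; apply: PL_opp.
  apply: PL_ext; [by apply: PL_mul => //; apply: PL_opp|exact: PL_cst|].
  by move=> x xf; rewrite trop_mul_finite // fr // subee.
- exact: PL_opp.
- by move=> x xf; rewrite fr.
Qed.

Lemma represents_min r r' : represents A r -> represents A r' ->
  represents A (fun x => Num.min (r x) (r' x)).
Proof.
move=> /represents_opp Hr /represents_opp Hr'.
apply: eq_represents (represents_opp (represents_max Hr Hr')) => x _.
by rewrite oppr_max !opprK.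
Qed.

Hypothesis constA : @trop_const R T `<=` A.

Lemma represents_cst (c : R) : represents A (cst c).
Proof. by exists (cst c%:E); split=> //; [apply: constA; exists c%:E|exact: PL_cst]. Qed.

Lemma represents_sum (I : Type) (s : seq I) (P : pred I) (r : I -> T -> R) :
  (forall i, P i -> represents A (r i)) -> represents A (fun x => \sum_(i <- s | P i) r i x).
Proof.
move=> H; elim: s => [|i s IHs].
  by apply: eq_represents (represents_cst 0) => x _; rewrite big_nil.
have [Pi|NPi] := boolP (P i); last first.
  by apply: eq_represents IHs => x _; rewrite big_cons (negPf NPi).
by apply: eq_represents (represents_add (H i Pi) IHs) => x _; rewrite big_cons Pi.
Qed.

Lemma represents_mulrz (m : int) r : represents A r -> represents A (fun x => m%:~R * r x).
Proof.
move=> Hr; wlog m0 : m / exists n : nat, m = n%:Z.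
  case: m => n H; first by apply: H; exists n.
  apply: eq_represents (represents_opp (H n.+1 (ex_intro _ n.+1 erefl))) => x _.
  by rewrite NegzE mulrNz mulNr.
case: m0 => n ->; elim: n => [|n IHn].
  by apply: eq_represents (represents_cst 0) => x _; rewrite mul0r.
by apply: eq_represents (represents_add Hr IHn) => x _; rewrite intS intrD mulrDl mul1r.
Qed.

End Subsemifield.
End RationalFunctions.

(** * Coordinates on edges and along paths *)

Section Glue.
Variables (R : realType) (X : topologicalType) (M : model R X) (Y : Type).

(** A model is the quotient of its edges by the identifications at vertices. *)
Lemma glue (p : vertex M -> Y) (phi : edge M -> \bar R -> Y) :
  (forall e, phi e 0%E = p (src e)) -> (forall e, phi e (len e) = p (tgt e)) ->
  exists F : X -> Y, forall (e : edge M) t, (0 <= t <= len e)%E -> F (chart e t) = phi e t.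
Proof.
move=> phi0 phil.
have /choice[F FP] : forall x : X, exists y, forall (e : edge M) t, (0 <= t <= len e)%E ->
    x = chart e t -> y = phi e t.
  move=> x; have [[v ->]|[e [t te ->]]] := model_surj M x.
    exists (p v) => e t te vt.
    have [t0|t0] := eqVneq t 0%E.
      by move: vt; rewrite t0 chart_src phi0 => /(@vpoint_inj _ _ M) ->.
    have [tl|tl] := eqVneq t (len e).
      by move: vt; rewrite tl chart_tgt phil => /(@vpoint_inj _ _ M) ->.
    have : (0 < t < len e)%E by rewrite !lt_neqAle eq_sym t0 tl.
    by move=> /chart_vpoint /(_ (esym vt)).
  by exists (phi e t) => e' t' te' /(chart_eq te te')[<- <-].
by exists F => e t te; apply: FP.
Qed.

End Glue.

Section Tree.
Variables (R : realType) (T : tropicalCurve R).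
Local Notation M := (curve_model T).
Implicit Types (e : edge M) (x : T) (t : R).
Hypothesis treeT : genus M = 0.

(** The target of an infinite edge is a leaf end, so no other edge continues the
    side of the target. *)
Lemma infinite_edge_side e v : len e = +oo%E -> side e v -> v = tgt e.
Proof.
move=> eoo; have leafe := @len_infty_tgt _ _ M e eoo.
have Nend p : p != (e, true) -> endpoint p != tgt e.
  by move=> pe; apply/eqP => E; case/eqP: pe; apply/esym/(@leaf_end_unique M (e, true)).
pose c v := side e v && (v != tgt e).
suff /connected_const/(_ v (src e)) : forall e' : edge M, c (src e') = c (tgt e').
  by rewrite /c side_src // => + sv; rewrite sv /= => /negbFE/eqP.
move=> e'; rewrite /c; have [<-|Ne] := eqVneq e e'; first by rewrite side_src // eqxx andbF.
have -> : src e' != tgt e by apply: (Nend (e', false)); rewrite xpair_eqE andbF.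
have -> : tgt e' != tgt e by apply: (Nend (e', true)); rewrite xpair_eqE andbT eq_sym.
by rewrite side_edge.
Qed.

Lemma side_src_finite e e' : side e (src e') -> (len e < +oo)%E.
Proof.
move=> se; rewrite ltey; apply/eqP => eoo.
have leafe := @len_infty_tgt _ _ M e eoo.
by have := @leaf_end_unique M (e, true) (e', false) leafe (esym (infinite_edge_side eoo se)).
Qed.

Lemma len_finite e e' : side e (src e') -> (fine (len e))%:E = len e.
Proof.
move=> /side_src_finite lf; rewrite fineK // ge0_fin_numE //.
exact/ltW/len_gt0.
Qed.

Lemma point_on_edge (e0 : edge M) x : exists e (t : \bar R), (0 <= t <= len e)%E /\ x = chart e t.
Proof.
have [[v ->]|[e [t /andP[/ltW t0 /ltW tl] ->]]] := model_surj M x; last first.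
  by exists e, t; rewrite t0 tl.
have [p <-] := ends_neq0 e0 v; exists p.1, (end_param p); rewrite chart_end; split=> //.
by have /ltW := len_gt0 p.1; rewrite /end_param; case: ifP => _ ->; rewrite lexx.
Qed.

Lemma finite_point (e0 : edge M) x : ~ at_infinity x ->
  exists e t, [/\ 0 <= t, (t%:E <= len e)%E & x = chart e t%:E].
Proof.
have [e [t [/andP[t0 tl] ->]]] := point_on_edge e0 x; case: t t0 tl => [t| |] // t0 tl.
  by exists e, t.
by case; exists e => //; apply/eqP; rewrite -leye_eq.
Qed.

(** The retraction of the tree onto [e], read in the coordinate of [e]. It is
    well defined because no other edge joins the two sides of [e]. *)
Lemma edge_coordinate e : exists f : T -> \bar R, PL f /\
  forall (e' : edge M) t, 0 <= t -> (t%:E <= len e')%E -> f (chart e' t%:E) =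
     (if e' == e then t else if side e (src e') then fine (len e) else 0)%:E.
Proof.
pose phi e' (t : \bar R) : \bar R :=
  if e' == e then t else if side e (src e') then len e else 0%E.
pose p v := if side e v then len e else 0%E.
have [||f fE] := @glue _ _ M _ p phi.
- move=> e'; rewrite /phi /p; have [->|//] := eqVneq e' e.
  by rewrite side_src.
- move=> e'; rewrite /phi /p; have [->|Ne] := eqVneq e' e; first by rewrite side_tgt.
  by rewrite side_edge // eq_sym.
have fEr (e' : edge M) t : 0 <= t -> (t%:E <= len e')%E -> f (chart e' t%:E) =
     (if e' == e then t else if side e (src e') then fine (len e) else 0)%:E.
  move=> t0 tl; rewrite fE ?lee_fin ?t0 // /phi; case: eqP => // _.
  by case: ifP => // /len_finite.
exists f; split=> //; split=> [e'|x]; last first.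
  by move=> /(finite_point e)[e' [t [t0 tl ->]]]; rewrite fEr.
pose psi (z : \bar R) := if e' == e then z else
  (if side e (src e') then fine (len e) else 0)%:E.
have germ_psi (F : set_system R) : Filter F -> affine_germ F psi.
  by move=> FF; rewrite /psi; case: eqP => _; [exact: germ_id|exact: germ_const].
have eqf (s : R) : 0 <= s /\ (s%:E <= len e')%E -> (f \o chart e') s%:E = psi s%:E.
  by move=> [s0 sl]; rewrite /= fEr // /psi; case: eqP.
split.
- move=> t t0 tl; apply: (eq_germ _ _ (germ_psi _ _)).
  by apply: filterS (near_right_finite t0 tl) => s /eqf.
- move=> t t0 tl; apply: (eq_germ _ _ (germ_psi _ _)).
  by apply: filterS (near_left_finite t0 tl) => s /eqf.
move=> eoo; have eq_oo : \forall s \near +oo, (f \o chart e') s%:E = psi s%:E.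
  by apply: filterS (near_infty_finite eoo) => s /eqf.
split; first exact: (eq_germ _ eq_oo (germ_psi _ _)).
have -> : (f \o chart e') +oo%E = psi +oo%E.
  rewrite /= fE ?eoo ?leey // /phi /psi; case: eqP => // _.
  by case: ifP => // /len_finite.
have : psi t%:E @[t --> +oo] --> psi +oo%E.
  by rewrite /psi; case: eqP => _; [apply/cvgeryP; exact: cvg_id|exact: cvg_cst].
by apply: cvg_trans; apply: near_eq_cvg; apply: filterS eq_oo => s ->.
Qed.

Lemma edge_coordinates : exists h : edge M -> T -> R,
  (forall e, exists f, [/\ PL f & forall x, ~ at_infinity x -> f x = (h e x)%:E]) /\
  forall e e' t, 0 <= t -> (t%:E <= len e')%E -> h e (chart e' t%:E) =
     if e' == e then t else if side e (src e') then fine (len e) else 0.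
Proof.
have /choice[f fP] := edge_coordinate; exists (fun e x => fine (f e x)); split.
  move=> e; exists (f e); have [fPL _] := fP e; split=> // x xf.
  by rewrite fineK //; apply: fPL.2.
by move=> e e' t t0 tl; rewrite (fP e).2.
Qed.

Variable h : edge M -> T -> R.
Hypothesis hE : forall e e' t, 0 <= t -> (t%:E <= len e')%E -> h e (chart e' t%:E) =
     if e' == e then t else if side e (src e') then fine (len e) else 0.

Definition orientation (b : bool) : int := if b then 1 else -1.

(** Up to an additive constant, the coordinate along the path from [a] to [b] of
    the projection to this path. *)
Definition path_coordinate (a b : vertex M) x : R :=
  \sum_(e | separates e a b) (orientation (side e b))%:~R * h e x.

Definition truncate (l : \bar R) (y : R) : R :=
  if l == +oo%E then Num.max y 0 else Num.min (Num.max y 0) (fine l).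

Lemma h_src e e' : h e (vpoint (m := M) (src e')) = if side e (src e') then fine (len e) else 0.
Proof.
have /ltW l0 := len_gt0 e'; have := hE e (lexx 0) l0.
by rewrite chart_src => ->; case: eqP => [->|//]; rewrite side_src.
Qed.

(** An edge [e'] of the path can distinguish a point outside [e] from the source
    of [e] only when it lies on the same side of [e] as that point; being also
    on the path from [a] to [b], it then contributes with the sign of this
    side. *)
Lemma path_coordinate_monotone a b e e' e1 t : separates e a b -> separates e' a b ->
  e != e' -> e1 != e -> 0 <= t -> (t%:E <= len e1)%E ->
  let d := (orientation (side e b))%:~R * ((orientation (side e' b))%:~R *
    (h e' (chart e1 t%:E) - h e' (vpoint (m := M) (src e)))) in
  if side e (src e1) then 0 <= d else d <= 0.
Proof.
move=> sep sep' Ne Ne1 t0 tl /=; set d := h e' _ - _.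
have [d0|[E dE]] : d = 0 \/ side e (src e1) = side e (src e') /\
    if side e' (src e) then d <= 0 else 0 <= d.
  rewrite /d h_src hE //; have [Ee|Ne'] := eqVneq e1 e'.
    right; rewrite /= Ee; split=> //; case se: (side e' (src e)); last by rewrite subr0.
    by rewrite subr_le0 -lee_fin (len_finite se) -Ee.
  have L := side_laminar Ne (src e1).
  have lf : 0 <= fine (len e') by rewrite fine_ge0 // ltW // len_gt0.
  have [->|ss] := eqVneq (side e' (src e1)) (side e' (src e)).
    by left; rewrite subrr.
  right; move: L; rewrite (negPf ss) orbF => /eqP ->; split=> //; move: ss.
  by case: (side e' (src e)); case: (side e' (src e1)) => //= _; lra.
by rewrite d0 !mulr0; case: ifP.
have La := side_laminar Ne a; have Lb := side_laminar Ne b.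
rewrite E; move: sep sep' La Lb dE; rewrite /separates /orientation.
case: (side e a); case: (side e b) => //=; case: (side e' a); case: (side e' b) => //=;
 case: (side e (src e')); case: (side e' (src e)) => //= *; lra.
Qed.

(** Along [e] only the summand of [e] varies; outside [e] all summands move in
    the same direction, beyond the values reached on [e], and are cut off. *)
Lemma truncate_path_coordinate a b e x : separates e a b -> ~ at_infinity x ->
  h e x = truncate (len e) ((orientation (side e b))%:~R *
    (path_coordinate a b x - path_coordinate a b (vpoint (m := M) (src e)))).
Proof.
move=> sep /(finite_point e)[e1 [t [t0 tl ->]]].
set y := _ * _.
have l0 := len_gt0 e.
have yE : y = h e (chart e1 t%:E) + \sum_(e' | separates e' a b && (e' != e))
    (orientation (side e b))%:~R * ((orientation (side e' b))%:~R *
    (h e' (chart e1 t%:E) - h e' (vpoint (m := M) (src e)))).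
  rewrite /y /path_coordinate -sumrB mulr_sumr (bigD1 e) //=; congr (_ + _).
    rewrite h_src side_src // mulr0 subr0 mulrA -intrM /orientation.
    by case: (side e b); rewrite mul1r.
  by apply: eq_bigr => e' _; rewrite -mulrBr.
have trunc0 : y <= 0 -> truncate (len e) y = 0.
  move=> y0; rewrite /truncate (max_idPr y0); case: eqP => // _.
  by apply/min_idPl; rewrite fine_ge0 // ltW.
have trunc_id : 0 <= y -> (y%:E <= len e)%E -> truncate (len e) y = y.
  move=> y0 yl; rewrite /truncate (max_idPl y0); case: eqP => // /eqP loo.
  apply/min_idPl; rewrite -lee_fin fineK // ge0_fin_numE ?ltey //.
  exact: ltW.
have [Ee|Ne] := eqVneq e1 e.
  have yt : y = t.
    rewrite yE big1 ?addr0; first by rewrite hE // Ee eqxx.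
    move=> e' /andP[_ Ne']; rewrite hE // h_src Ee eq_sym (negPf Ne').
    by rewrite subrr !mulr0.
  by rewrite trunc_id ?yt // -?Ee // hE // Ee eqxx.
have mono e' (H : separates e' a b && (e' != e)) :=
  @path_coordinate_monotone a b e e' e1 t sep (andP H).1.
rewrite hE // (negPf Ne) in yE *; case: ifP yE mono => se yE mono; last first.
  rewrite trunc0 // yE add0r; apply: sumr_le0 => e' He'.
  by apply: (mono e' He') => //; rewrite eq_sym; case/andP: He'.
have yl : fine (len e) <= y.
  rewrite yE lerDl; apply: sumr_ge0 => e' He'.
  by apply: (mono e' He') => //; rewrite eq_sym; case/andP: He'.
rewrite /truncate -(len_finite se) /= (max_idPl _); last first.
  by apply: le_trans yl; rewrite fine_ge0 // ltW.
by apply/esym/min_idPr.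
Qed.

(** * Generation by the coordinates of the edges *)

Section Generation.
Variable A : set (T -> \bar R).
Hypothesis subA : subsemifield A.
Hypothesis constA : @trop_const R T `<=` A.

Lemma represents_truncate (l : \bar R) r : represents A r ->
  represents A (fun x => truncate l (r x)).
Proof.
move=> Hr; have H := represents_max subA Hr (represents_cst constA 0).
rewrite /truncate; case: eqP => // _.
exact: (represents_min subA H (represents_cst constA (fine l))).
Qed.

Lemma affine_pieces_le (phi : \bar R -> \bar R) c s : affine_pieces phi c s -> (c <= last c s)%E.
Proof. by elim: s c => //= y s IHs c [cy _ /IHs]; apply/le_trans/ltW. Qed.

(** The first piece, stopped at its right end, and the remaining pieces, started
    there, add up to the whole after subtracting the common value. *)
Lemma represents_pieces (phi : \bar R -> \bar R) s (c : R) r : affine_pieces phi c%:E s ->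
  represents A r ->
  represents A (fun x => fine (phi (Order.min (Num.max (r x) c)%:E (last c%:E s)))).
Proof.
elim: s c => [|y s IHs] c /=.
  move=> _ Hr; apply: eq_represents (represents_cst constA (fine (phi c%:E))) => x _ /=.
  by rewrite (min_idPr _) // lee_fin le_max lexx orbT.
move=> [cy [m [q HA]] Hs] Hr.
have Hm := represents_max subA Hr (represents_cst constA c).
have affine r' : represents A r' -> represents A (fun x => m%:~R * r' x + q).
  move=> Hr'; have H := represents_mulrz subA constA m Hr'.
  exact: (represents_add subA H (represents_cst constA q)).
case: y cy HA Hs => [y| |] // cy HA Hs; last first.
  have -> : last +oo%E s = +oo%E.
    by case: s Hs {IHs} => //= z s [/lt_le_trans/(_ (leey z))]; rewrite ltxx.
  apply: eq_represents (affine _ Hm) => x _ /=.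
  by rewrite (min_idPl _) ?leey // HA // lee_fin le_max lexx orbT leey.
rewrite lte_fin in cy.
have H1 := affine _ (represents_min subA Hm (represents_cst constA y)).
have H2 := represents_add subA (IHs y Hs Hr) (represents_cst constA (- fine (phi y%:E))).
apply: eq_represents (represents_add subA H1 H2) => x _ /=.
have yl := affine_pieces_le Hs.
have phiE z : c <= z -> z <= y -> m%:~R * z + q = fine (phi z%:E).
  by move=> cz zy; rewrite HA ?lee_fin ?cz.
rewrite phiE; [|by rewrite le_min le_max lexx orbT ltW|by rewrite ge_min lexx orbT].
have [zy|yz] := leP (Num.max (r x) c) y.
  move: (zy); rewrite ge_max => /andP[ry _].
  rewrite (max_idPr ry) (min_idPl yl) subrr addr0 (min_idPl _) //.
  by apply: le_trans yl; rewrite lee_fin.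
have yr : y < r x by move: yz; rewrite lt_max => /orP[//|/(lt_trans cy)]; rewrite ltxx.
rewrite (max_idPl (ltW yr)) (max_idPl (ltW (lt_trans cy yr))); ring.
Qed.

Hypothesis hA : forall e, represents A (h e).

(** A point at infinity may carry any value of [D], so the comparison between
    adjacent vertices goes through the sources of edges, which are finite. *)
Lemma constant_on_tree (D : T -> R) :
  (forall e t, 0 <= t -> (t%:E <= len e)%E -> D (chart e t%:E) = D (vpoint (m := M) (src e))) ->
  exists K, forall x, ~ at_infinity x -> D x = K.
Proof.
move=> De; have [[e0 _]|N] := pselect (exists e : edge M, True); last first.
  have [v0 _] : exists v : vertex M, true.
    by have /card_gt0P[w _] := multigraph_nonempty M; exists w.
  exists (D (vpoint (m := M) v0)) => x _.
  have [[v ->]|[e _]] := model_surj M x; last by case: N; exists e.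
  by rewrite (@connected_const M _ id _ v v0) // => e; case: N; exists e.
have /choice[p pP] := ends_neq0 e0.
pose c v := D (vpoint (m := M) (src (p v).1)).
have cE q : c (endpoint q) = D (vpoint (m := M) (src q.1)).
  rewrite /c; have := pP (endpoint q); move: (p _) => {c p pP}p pq.
  have [leafq|Nleaf] := boolP (leaf_end (endpoint q)).
    by rewrite (leaf_end_unique leafq (esym pq)).
  have DE r : ~~ leaf_end (endpoint r) -> D (vpoint (m := M) (endpoint r)) = D (vpoint (m := M) (src r.1)).
    move=> Nr; case: r Nr => e [] // Nr; rewrite /endpoint /= -chart_tgt.
    have lf : len e \is a fin_num.
      rewrite ge0_fin_numE ?ltey; last exact/ltW/len_gt0.
      by apply: contra Nr => /eqP/len_infty_tgt.
    rewrite -(fineK lf) De ?fineK //.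
    exact/fine_ge0/ltW/len_gt0.
  by rewrite -(DE p) pq // DE.
exists (c (src e0)) => x /(finite_point e0)[e [t [t0 tl ->]]].
rewrite De // -[LHS](cE (e, false)) /=.
by apply: (@connected_const M) => e'; rewrite (cE (e', false)) (cE (e', true)).
Qed.

(** Subtracting from [g] its restrictions to the edges, pulled back along the
    retractions, leaves a function that does not vary along any edge: on an edge
    the pullback from this edge is [g], those from other edges are constant. *)
Lemma rational_generated : @Defs.rational R T `<=` A.
Proof.
move=> g /rational_PL[->|gP]; first by have [_ [A0 _] _ _ _] := subA.
pose D x := fine (g x) - \sum_e fine (g (chart e (h e x)%:E)).
have [|K DK] := @constant_on_tree D.
  move=> e t t0 tl; rewrite /D -[in RHS]chart_src.
  have /ltW l0 := len_gt0 e.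
  rewrite (bigD1 e) //= [in RHS](bigD1 e) //= !hE // eqxx !opprD !addrA !subrr.
  congr (_ - _); apply: eq_bigr => e' Ne.
  by rewrite !hE // eq_sym (negPf Ne).
suff H : represents A (fun x => \sum_e fine (g (chart e (h e x)%:E)) + K).
  apply: represents_mem H _ => // x xf.
  by rewrite -(DK x xf) /D addrC subrK fineK // gP.2.
apply: (represents_add subA) (represents_cst constA K).
apply: (represents_sum subA constA) => e _.
have [s Hs sl] := locally_affine_pieces (len_gt0 e) (gP.1 e).
apply: eq_represents (represents_pieces Hs (hA e)) => x xf /=.
rewrite sl; have [e1 [t [t0 tl ->]]] := finite_point e xf.
have /ltW l0 := len_gt0 e.
have h0 : 0 <= h e (chart e1 t%:E).
  by rewrite hE //; case: ifP => // _; case: ifP => // _; apply: fine_ge0.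
rewrite (max_idPl h0) (min_idPl _) // hE //; case: eqP tl => [-> //|_ tl].
by case: ifP => // /len_finite->.
Qed.

End Generation.
End Tree.

(** * The bound on the number of generators *)

Lemma trop_const_rational (R : realType) (T : tropicalCurve R) :
  @trop_const R T `<=` @Defs.rational R T.
Proof.
move=> _ [[c| |] coo <-]; [by apply: PL_rational; apply: PL_cst|by case: coo|by left].
Qed.

Lemma tree_generators (R : realType) (T : tropicalCurve R) : is_tree T ->
  exists F : 'I_(uphalf #|leaf_ends (curve_model T)|) -> T -> \bar R,
    generating_set (range F).
Proof.
move=> treeT; have [y ycov] := leaf_pairs_cover treeT.
have [h [h_rep hE]] := edge_coordinates treeT.
have ratS := @rational_subsemifield R T.
have ratC := @trop_const_rational R T.
pose r i := path_coordinate h (y (i, false)) (y (i, true)).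
have /choice[F FP] : forall i, represents (@Defs.rational R T) (r i).
  move=> i; apply: (represents_sum ratS ratC) => e _.
  apply: (represents_mulrz ratS ratC); have [f [fP fh]] := h_rep e.
  by exists f; split=> //; apply: PL_rational.
have Frat : range F `<=` @Defs.rational R T by move=> _ [i _ <-]; have [] := FP i.
exists F; split=> //; apply/seteqP; split.
  by apply: smallest_sub => // f [/ratC//|/Frat].
move=> f fr A [subA]; rewrite subUset => -[constA FA].
apply: (rational_generated treeT hE subA constA) => // e.
have [i sep] := ycov e.
have Ar : represents A (r i).
  by have [_ Fi_PL Fi_r] := FP i; exists (F i); split=> //; apply: FA; exists i.
apply: eq_represents (represents_truncate subA constA (len e) _) => [x xf|].
  exact/esym/(truncate_path_coordinate treeT hE sep).
apply: (represents_mulrz subA constA).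
exact: (represents_add subA Ar (represents_cst constA _)).
Qed.

Theorem proposition3p11 (R : realType) (T : tropicalCurve R)
    (G0 : model R T) :
  is_tree T -> is_canonical_model G0 ->
  exists (S : set (T -> \bar R)) (n : nat),
    [/\ generating_set S, (S #= `I_n)%card &
        (n%:R : R) <= (Num.floor (#|leaf_ends G0|%:R + 1 : R))%:~R / 2].
Proof.
move=> treeT _; have [F Fgen] := tree_generators treeT.
set k := uphalf _ in F Fgen.
have Fk : (range F #<= `I_k)%card.
  by rewrite (card_le_eqr card_II); apply: card_image_le.
have [n Fn] : exists n, (range F #= `I_n)%card.
  by apply/finite_setP/(card_le_finite Fk)/finite_II.
exists (range F), n; split=> //.
have nk : (n <= k)%N by rewrite -card_le_II -(card_le_eql Fn).
have kL : (k.*2 <= #|leaf_ends G0|.+1)%N.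
  have := leaf_ends_le (curve_model T) G0.
  by rewrite /k; have := uphalf_half #|leaf_ends (curve_model T)|; lia.
have -> : Num.floor (#|leaf_ends G0|%:R + 1 : R) = (#|leaf_ends G0|.+1)%:Z.
  by rewrite natr1 pmulrn intrKfloor.
rewrite -pmulrn ler_pdivlMr // -natrM ler_nat.
by rewrite muln2 (leq_trans _ kL) // leq_double.
Qed.
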